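(* Let $a<b$, $0<\alpha,\beta<1$, and $y_a,y_b,l\in\mathbb R$. Let $L,g:[a,b]\times\mathbb R^3\to\mathbb R$ be of class $C^1$ and, for $y\in{}_a^{\alpha}E_b^{\beta}$, put $$J(y)=\int_a^b L[y](x)\,dx,\qquad I(y)=\int_a^b g[y](x)\,dx,\qquad [y](x)=\big(x,y(x),{}_a^CD_x^\alpha y(x),{}_x^CD_b^\beta y(x)\big).$$ Assume that $\partial_3L$ and $\partial_3g$ have continuous right Riemann--Liouville derivatives of order $\alpha$ and that $\partial_4L$ and $\partial_4g$ have continuous left Riemann--Liouville derivatives of order $\beta$ on $[a,b]$. Let $y\in{}_a^{\alpha}E_b^{\beta}$ be a local minimum of $J$ subject to the conditions $$y(a)=y_a,\qquad y(b)=y_b,\qquad I(y)=l.$$ If $y$ is not an extremal for the functional $I$, then there exists a constant $\lambda\in\mathbb R$ such that, with $F=L+\lambda g$, $$\partial_2 F[y](x)+{}_xD_b^\alpha\, \partial_3 F[y](x)+{}_aD_x^\beta\,\partial_4 F[y](x)=0\qquad\text{for all }x\in[a,b].$$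
   Context: Fractional operators. Let $0<\gamma<1$ and let $\Gamma$ be the Euler gamma function. The left and right Riemann--Liouville derivatives of order $\gamma$ are $${}_aD_x^\gamma f(x)=\frac{1}{\Gamma(1-\gamma)}\frac{d}{dx}\int_a^x (x-t)^{-\gamma}f(t)\,dt,\qquad {}_xD_b^\gamma f(x)=\frac{-1}{\Gamma(1-\gamma)}\frac{d}{dx}\int_x^b (t-x)^{-\gamma}f(t)\,dt$$ (one-sided derivatives at endpoints). The left and right Caputo derivatives are, for absolutely continuous $f:[a,b]\to\mathbb R$, $${}_a^CD_x^\gamma f(x)=\frac{1}{\Gamma(1-\gamma)}\int_a^x (x-t)^{-\gamma}f'(t)\,dt,\qquad {}_x^CD_b^\gamma f(x)=\frac{-1}{\Gamma(1-\gamma)}\int_x^b (t-x)^{-\gamma}f'(t)\,dt,$$ with the value at $x=a$ (left) or $x=b$ (right) understood as the limit. Function space: ${}_a^{\alpha}E_b^{\beta}$ is the set of $y:[a,b]\to\mathbb R$ for which ${}_a^CD_x^\alpha y$ and ${}_x^CD_b^\beta y$ exist and are continuous on $[a,b]$. $\partial_i$ denotes the partial derivative with respect to the $i$-th variable, $i=1,2,3,4$, of a function of $(x,y,u,v)$. Fractional derivatives of $\partial_3L$, $\partial_4L$, $\partial_3 g$, $\partial_4 g$ are taken of the functions $x\mapsto\partial_iL[y](x)$, $x\mapsto\partial_ig[y](x)$. A function $y\in{}_a^{\alpha}E_b^{\beta}$ satisfying $y(a)=y_a$, $y(b)=y_b$, $I(y)=l$ is called admissible. An admissible $y$ is an extremal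 for $I$ if $$\partial_2 g[y](x)+{}_xD_b^\alpha\,\partial_3 g[y](x)+{}_aD_x^\beta\,\partial_4 g[y](x)=0\quad\text{for all }x\in[a,b].$$ Fix a norm $\|\cdot\|$ on ${}_a^{\alpha}E_b^{\beta}$ (any norm). $y$ is a local minimum of $J$ subject to the conditions if it is admissible and there is $\delta>0$ with $J(y)\le J(y_1)$ for every admissible $y_1$ with $\|y-y_1\|<\delta$. *)

(* Defs.v *)
From HB Require Import structures.
From mathcomp Require Import all_boot all_order all_algebra.
From mathcomp Require Import all_classical all_reals all_analysis.
Set Implicit Arguments.
Unset Strict Implicit.
Unset Printing Implicit Defensive.
Import Order.TTheory GRing.Theory Num.Theory.
Import numFieldNormedType.Exports.
Local Open Scope classical_set_scope.
Local Open Scope ring_scope.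

(* Functions on [a, b] are total functions R -> R of which only the values on
   `[a, b] matter. *)

Definition Gamma (R : realType) (z : R) : R :=
  \int[@lebesgue_measure R]_(t in `]0, +oo[) (t `^ (z - 1) * expR (- t)).

(* The derivative relative to [a, b]: the usual two-sided derivative in the
   interior, the one-sided one at a and at b. *)
Definition derivable_on_itv (R : realType) (a b : R) (f : R -> R) (x : R) :
    Prop :=
  cvg ((fun t => (f t - f x) / (t - x)) @ within `[a, b] x^').

Definition derive_on_itv (R : realType) (a b : R) (f : R -> R) (x : R) : R :=
  lim ((fun t => (f t - f x) / (t - x)) @ within `[a, b] x^').

Definition left_kernel (R : realType) (gam : R) (f : R -> R) (x t : R) : R :=
  (x - t) `^ (- gam) * f t.

Definition right_kernel (R : realType) (gam : R) (f : R -> R) (x t : R) : R :=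
  (t - x) `^ (- gam) * f t.

Definition left_integral (R : realType) (a gam : R) (f : R -> R) (x : R) : R :=
  \int[@lebesgue_measure R]_(t in `[a, x]) left_kernel gam f x t.

Definition right_integral (R : realType) (b gam : R) (f : R -> R) (x : R) : R :=
  \int[@lebesgue_measure R]_(t in `[x, b]) right_kernel gam f x t.

Definition RL_left (R : realType) (a b gam : R) (f : R -> R) (x : R) : R :=
  1 / Gamma (1 - gam) * derive_on_itv a b (left_integral a gam f) x.

Definition RL_right (R : realType) (a b gam : R) (f : R -> R) (x : R) : R :=
  -1 / Gamma (1 - gam) * derive_on_itv a b (right_integral b gam f) x.

Definition has_continuous_RL_left (R : realType) (a b gam : R) (f : R -> R) :
    Prop :=
  [/\ forall x, x \in `[a, b] ->
        (@lebesgue_measure R).-integrable `[a, x]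
          (EFin \o left_kernel gam f x),
      forall x, x \in `[a, b] ->
        derivable_on_itv a b (left_integral a gam f) x &
      {within `[a, b], continuous (RL_left a b gam f)}].

Definition has_continuous_RL_right (R : realType) (a b gam : R) (f : R -> R) :
    Prop :=
  [/\ forall x, x \in `[a, b] ->
        (@lebesgue_measure R).-integrable `[x, b]
          (EFin \o right_kernel gam f x),
      forall x, x \in `[a, b] ->
        derivable_on_itv a b (right_integral b gam f) x &
      {within `[a, b], continuous (RL_right a b gam f)}].

Definition absolutely_continuous (R : realType) (a b : R) (f : R -> R) : Prop :=
  forall e : R, 0 < e -> exists2 d : R, 0 < d &
    forall (n : nat) (u v : 'I_n -> R),
      (forall i, a <= u i /\ u i <= v i /\ v i <= b) ->
      trivIset setT (fun i => `]u i, v i[%classic) ->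
      \sum_(i < n) (v i - u i) < d ->
      \sum_(i < n) `|f (v i) - f (u i)| < e.

Definition caputo_left_integral (R : realType) (a gam : R) (f : R -> R)
    (x : R) : R :=
  1 / Gamma (1 - gam) * left_integral a gam (derive1 f) x.

Definition caputo_right_integral (R : realType) (b gam : R) (f : R -> R)
    (x : R) : R :=
  -1 / Gamma (1 - gam) * right_integral b gam (derive1 f) x.

Definition caputo_left (R : realType) (a gam : R) (f : R -> R) (x : R) : R :=
  if x == a then lim (caputo_left_integral a gam f t @[t --> a^'+])
  else caputo_left_integral a gam f x.

Definition caputo_right (R : realType) (b gam : R) (f : R -> R) (x : R) : R :=
  if x == b then lim (caputo_right_integral b gam f t @[t --> b^'-])
  else caputo_right_integral b gam f x.

(* derive1 f is a total function, so that f' is defined almost everywhere is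
   stated explicitly; for an absolutely continuous f this is no restriction,
   by Lebesgue's theorem.  Continuity at a (resp. b) of caputo_left (resp.
   caputo_right) contains the existence of the limit defining its value. *)
Definition space_E (R : realType) (a b alp bet : R) (f : R -> R) : Prop :=
  [/\ absolutely_continuous a b f /\
      {ae @lebesgue_measure R, forall t, t \in `[a, b] -> derivable f t 1},
      forall x, x \in `]a, b] ->
        (@lebesgue_measure R).-integrable `[a, x]
          (EFin \o left_kernel alp (derive1 f) x),
      {within `[a, b], continuous (caputo_left a alp f)},
      forall x, x \in `[a, b[ ->
        (@lebesgue_measure R).-integrable `[x, b]
          (EFin \o right_kernel bet (derive1 f) x) &
      {within `[a, b], continuous (caputo_right b bet f)}].

(* A norm on the vector space E; two functions are the same element of E when
   they agree on [a, b]. *)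
Definition is_norm_on_E (R : realType) (a b alp bet : R)
    (N : (R -> R) -> R) : Prop :=
  [/\ forall f, space_E a b alp bet f -> 0 <= N f,
      forall f, space_E a b alp bet f ->
        (N f = 0 <-> forall x, x \in `[a, b] -> f x = 0),
      forall (c : R) f, space_E a b alp bet f -> N (c *: f) = `|c| * N f &
      forall f h, space_E a b alp bet f -> space_E a b alp bet h ->
        N (f + h) <= N f + N h].

Definition partial1 (R : realType) (a b : R) (L : R -> R -> R -> R -> R)
    (x y u v : R) : R := derive_on_itv a b (fun s => L s y u v) x.

Definition partial2 (R : realType) (L : R -> R -> R -> R -> R)
    (x y u v : R) : R := derive1 (fun s => L x s u v) y.

Definition partial3 (R : realType) (L : R -> R -> R -> R -> R)
    (x y u v : R) : R := derive1 (fun s => L x y s v) u.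

Definition partial4 (R : realType) (L : R -> R -> R -> R -> R)
    (x y u v : R) : R := derive1 (fun s => L x y u s) v.

Definition continuous_on_slab (R : realType) (a b : R)
    (L : R -> R -> R -> R -> R) : Prop :=
  {within [set p : R * R * R * R | p.1.1.1 \in `[a, b]],
    continuous (fun p : R * R * R * R => L p.1.1.1 p.1.1.2 p.1.2 p.2)}.

Definition C1_on_slab (R : realType) (a b : R)
    (L : R -> R -> R -> R -> R) : Prop :=
  (forall x y u v : R, x \in `[a, b] ->
     [/\ derivable_on_itv a b (fun s => L s y u v) x,
         derivable (fun s => L x s u v) y 1,
         derivable (fun s => L x y s v) u 1 &
         derivable (fun s => L x y u s) v 1]) /\
  [/\ continuous_on_slab a b (partial1 a b L),
      continuous_on_slab a b (partial2 L),
      continuous_on_slab a b (partial3 L) &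
      continuous_on_slab a b (partial4 L)].

(* L[y](x) *)
Definition along (R : realType) (a b alp bet : R) (L : R -> R -> R -> R -> R)
    (y : R -> R) (x : R) : R :=
  L x (y x) (caputo_left a alp y x) (caputo_right b bet y x).

Definition functional (R : realType) (a b alp bet : R)
    (L : R -> R -> R -> R -> R) (y : R -> R) : R :=
  \int[@lebesgue_measure R]_(x in `[a, b]) along a b alp bet L y x.

Definition admissible (R : realType) (a b alp bet ya yb l : R)
    (g : R -> R -> R -> R -> R) (y : R -> R) : Prop :=
  [/\ space_E a b alp bet y, y a = ya, y b = yb &
      functional a b alp bet g y = l].

Definition local_minimum (R : realType) (a b alp bet ya yb l : R)
    (N : (R -> R) -> R) (L g : R -> R -> R -> R -> R) (y : R -> R) : Prop :=
  admissible a b alp bet ya yb l g y /\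
  exists2 d : R, 0 < d &
    forall y1, admissible a b alp bet ya yb l g y1 -> N (y - y1) < d ->
      functional a b alp bet L y <= functional a b alp bet L y1.

Definition euler_lagrange (R : realType) (a b alp bet : R)
    (F : R -> R -> R -> R -> R) (y : R -> R) : Prop :=
  forall x, x \in `[a, b] ->
    along a b alp bet (partial2 F) y x
    + RL_right a b alp (along a b alp bet (partial3 F) y) x
    + RL_left a b bet (along a b alp bet (partial4 F) y) x = 0.

Definition extremal (R : realType) (a b alp bet ya yb l : R)
    (g : R -> R -> R -> R -> R) (y : R -> R) : Prop :=
  admissible a b alp bet ya yb l g y /\ euler_lagrange a b alp bet g y.

(* Main.v *)
Require Import Defs.
From HB Require Import structures.
From mathcomp Require Import all_boot all_order all_algebra.
From mathcomp Require Import all_classical all_reals all_analysis.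
From mathcomp Require Import measurable_realfun ring lra.
Set Implicit Arguments.
Unset Strict Implicit.
Unset Printing Implicit Defensive.
Import Order.TTheory GRing.Theory Num.Theory.
Import numFieldNormedType.Exports.
Local Open Scope classical_set_scope.
Local Open Scope ring_scope.

(** A test variation is taken of the form h(x) = \int_a^x f with f continuous
    of mean value zero.  Fractional integration by parts (Fubini for the kernels
    (x - t)^(-gam)) turns the first variation of \int L[y] along h into
    \int f Q_L, where Q_L collects a primitive of d_2 L[y] and the fractional
    integrals of d_3 L[y] and d_4 L[y]; the Euler-Lagrange expression of L is
    -Q_L', so it vanishes as soon as Q_L is constant.
    If y is not extremal for I, then Q_g is not constant and the test function
    f2 = Q_g - mean has \int f2 Q_g = \int f2^2 > 0.  Put
    lam = - \int f2 Q_L / \int f2 Q_g, let f1 be Q_(L + lam g) minus its mean, and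
    let w be the combination f1 + k f2 with \int w Q_g = 0.  For small s the
    intermediate value theorem gives r = o(s) such that the variation s w + r f2
    keeps I = l; minimality for both signs of s forces
    0 = \int w Q_L = \int f1^2, i.e. Q_(L + lam g) is constant. *)

(** * Clamping and improper integrals *)

(** The functions d_3 L[y] and d_4 L[y] are not assumed differentiable; only their fractional
    integrals are. Hence integration by parts moves kernels and never a derivative, and variations
    are parametrised by f = h' instead of h: every continuous f is allowed, and mean value zero is
    exactly h(b) = 0. For the same reason Q is first shown to be constant, and is differentiated
    only at the very end. The norm on E is arbitrary and controls neither h nor its Caputo
    derivatives. Minimality is therefore used only on a plane spanned by two fixed variations, where
    homogeneity and the triangle inequality bound the norm by the two parameters. A further obstacle
    is that y is differentiable only almost everywhere while [derive1] is total, so the effect of a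
    variation on [derive1 y] has to be followed through the points where y has no derivative. *)

(* Precomposition with [clamp] turns continuity within [a, b] into continuity
   on R. *)
Definition clamp (R : realType) (a b x : R) : R := Num.max a (Num.min b x).

Lemma clamp_in (R : realType) (a b x : R) : a <= b -> clamp a b x \in `[a, b].
Proof. by move=> ab; rewrite in_itv/= /clamp le_max lexx ge_max ab ge_min lexx. Qed.

Lemma clamp_id (R : realType) (a b x : R) : x \in `[a, b] -> clamp a b x = x.
Proof.
by rewrite in_itv/= => /andP[ax xb]; rewrite /clamp (min_idPr xb) (max_idPr ax).
Qed.

Lemma continuous_clamp (R : realType) (a b : R) : continuous (clamp a b).
Proof.
move=> x; apply: (@continuous_max _ _ (cst a) (Num.min b)).
  exact: cst_continuous.
by apply: (@continuous_min _ _ (cst b) id); [exact: cst_continuous|by move=> y; exact: cvg_id].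
Qed.

Lemma continuous_within_comp (T U V : topologicalType) (A : set T)
    (f : T -> V) (p : U -> T) :
  {within A, continuous f} -> continuous p -> (forall u, A (p u)) ->
  continuous (f \o p).
Proof.
move=> /subspace_continuousP cf cp Ap u.
apply: cvg_trans (cf _ (Ap u)) => B /=; rewrite !nbhs_simpl/= => fB.
have := cp u _ fB; rewrite !nbhs_simpl/=; apply: filterS => t; exact.
Qed.

Lemma continuous_clamp_comp (R : realType) (V : topologicalType) (a b : R)
    (f : R -> V) : a <= b ->
  {within `[a, b], continuous f} -> continuous (f \o clamp a b).
Proof.
move=> ab cf; apply: continuous_within_comp cf _ _.
  exact: continuous_clamp.
by move=> u /=; exact: clamp_in.
Qed.

Section improper_integral.
Variable R : realType.
Notation mu := (@lebesgue_measure R).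

(** A power kernel may blow up at one end of [u, v], so the classical formula is applied on
    [u + e i, v - e i]. Monotone convergence takes care of the integrals, continuity of F up to the
    ends of the right-hand side. *)
Lemma ge0_FTC2_oo (f F : R -> R) (u v : R) : u < v ->
  {in `]u, v[, forall x, (0 <= f x)%R} ->
  {in `]u, v[, continuous f} ->
  {in `]u, v[, forall x : R, is_derive x 1 F (f x)} ->
  {within `[u, v], continuous F} ->
  (\int[mu]_(x in `[u, v]) (f x)%:E = (F v - F u)%:E)%E.
Proof.
move=> uv f0 cf dF cF.
(* Starting at 3 gives u + e i < v - e i already for i = 0. *)
pose e (i : nat) := (v - u) / i.+3%:R.
have e0 i : 0 < e i by rewrite divr_gt0 ?subr_gt0.
have e3 i : e i * 3 <= v - u.
  rewrite /e mulrAC ler_pdivrMr ?ltr0n// ler_pM2l ?subr_gt0// ler_nat.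
  by [].
have ndec i j : (i <= j)%N -> e j <= e i.
  move=> ij; rewrite /e ler_pM2l ?subr_gt0// lef_pV2 ?posrE ?ltr0n//.
  by rewrite ler_nat !ltnS.
have ecvg : e @ \oo --> 0.
  rewrite -(mulr0 (v - u)); apply: cvgMr.
  have := @cvg_harmonic R; rewrite -(cvg_shiftn 2); apply: cvg_trans.
  by apply: near_eq_cvg; near=> n; rewrite /harmonic/= addn2.
pose A i := `[u + e i, v - e i]%classic.
have AS i x : A i x -> x \in `]u, v[.
  rewrite /A/= !in_itv/= => /andP[h1 h2]; have := e0 i.
  by move=> ?; apply/andP; split; lra.
have mf : measurable_fun `]u, v[ f.
  apply: open_continuous_measurable_fun; first exact: interval_open.
  by move=> x /[!inE]; exact: cf.
have UA : \bigcup_i A i = `]u, v[%classic.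
  apply/seteqP; split => [x [i _ /AS//]|x /=].
  rewrite in_itv/= => /andP[ux xv].
  have m0 : 0 < Num.min (x - u) (v - x) by rewrite lt_min !subr_gt0 ux.
  have /cvgrPdist_lt/(_ _ m0)[n _ /(_ n (leqnn n))] := ecvg.
  rewrite /= sub0r normrN gtr0_norm// lt_min => /andP[h1 h2].
  by exists n => //; rewrite /A/= in_itv/=; apply/andP; split; lra.
have H : (\int[mu]_(x in A i) (f x)%:E)%E @[i --> \oo] -->
    (\int[mu]_(x in `[u, v]) (f x)%:E)%E.
  rewrite (@integral_itv_bndoo _ _ _ _ true false); last exact/measurable_EFinP.
  rewrite -UA; apply: ge0_nondecreasing_set_cvg_integral.
  - move=> i j ij; apply/subsetPset => x; rewrite /A/= !in_itv/=.
    by have := ndec _ _ ij => ? /andP[? ?]; apply/andP; split; lra.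
  - by move=> i; exact: measurable_itv.
  - move=> i; apply/measurable_EFinP; apply: measurable_funS mf => //.
    exact: AS.
  - by move=> i x /AS/f0; rewrite lee_fin.
have AE i : (\int[mu]_(x in A i) (f x)%:E = (F (v - e i))%:E - (F (u + e i))%:E)%E.
  have := e0 i; have := e3 i => e3i e0i.
  have sAi : {subset `[u + e i, v - e i] <= `]u, v[} by move=> x /AS.
  have cFi : {within `[u + e i, v - e i], continuous F}.
    apply: continuous_subspaceW cF => x /sAi; exact: subset_itv_oo_cc.
  apply: continuous_FTC2.
  - by lra.
  - by apply: continuous_in_subspaceT => x /[!inE] /sAi; exact: cf.
  - have h : u + e i < v - e i by lra.
    have [_ h1 h2] := (continuous_within_itvP _ h).1 cFi.
    split => // x xi; apply: (@ex_derive _ _ _ _ _ _ _ (dF _ _)).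
    by apply: sAi; exact: subset_itv_oo_cc.
  - move=> x xi; rewrite derive1E; have := dF x (sAi _ (subset_itv_oo_cc xi)).
    by move=> h; rewrite derive_val.
suff: ((F (v - e i))%:E - (F (u + e i))%:E)%E @[i --> \oo] --> (F v - F u)%:E.
  under eq_fun do rewrite -AE.
  by move=> AFcvg; exact: cvg_unique H AFcvg.
under eq_fun do rewrite -EFinB.
  apply: cvg_EFin; first exact: nearW.
  have /subspace_continuousP cF' := cF.
  apply: cvgB.
  - apply: (cvg_comp _ _ _ (cF' v _)); last by rewrite /= in_itv/= lexx ltW.
    move=> B /= [d d0 dB]; have /cvgrPdist_lt/(_ _ d0) := ecvg.
    apply: filterS => n; rewrite sub0r normrN => h; apply: dB.
      by rewrite /ball/= opprB addrCA subrr addr0.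
    rewrite /= in_itv/=; move: (e0 n) (e3 n) => ? ?.
    by apply/andP; split; lra.
  - apply: (cvg_comp _ _ _ (cF' u _)); last by rewrite /= in_itv/= lexx ltW.
    move=> B /= [d d0 dB]; have /cvgrPdist_lt/(_ _ d0) := ecvg.
    apply: filterS => n; rewrite sub0r normrN => h; apply: dB.
      by rewrite /ball/= opprD addrA subrr sub0r normrN.
    rewrite /= in_itv/=; move: (e0 n) (e3 n) => ? ?.
    by apply/andP; split; lra.
Unshelve. all: by end_near. Qed.

End improper_integral.

(** * Explicit integrals of the power kernels *)

Section power_kernel.
Variable R : realType.
Notation mu := (@lebesgue_measure R).

(** Cutting the base off at 0 keeps the conventional values of the power at negative bases out. The
    primitives of the kernels built this way are continuous on R and agree with the uncut ones where
    they are integrated. *)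
Lemma continuous_powR_max0 (p : R) : 0 < p ->
  continuous (fun s : R => (Num.max 0 s) `^ p).
Proof.
move=> p0; suff : continuous ((@powR R ^~ p) \o (fun s : R => Num.max 0 s)) by [].
apply: (@continuous_within_comp R R R `[0, +oo[%classic).
- apply/continuous_within_itvcyP; split.
    move=> x; rewrite in_itv/= andbT => x0.
    apply/differentiable_continuous/derivable1_diffP.
    by apply: derivable_powR; rewrite in_itv/= andbT.
  by rewrite powR0 ?gt_eqF//; exact: powR_cvg0.
- move=> x; apply: (@continuous_max _ _ (cst 0) id); first exact: cst_continuous.
  by move=> y; exact: cvg_id.
- by move=> s; rewrite /= in_itv/= andbT le_max lexx.
Qed.

(** The delicate case is v = x: the integrand may be singular there, but its primitive stays
    continuous because 1 - gam > 0. *)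
Lemma integral_powRBl (gam x u v : R) : gam < 1 -> u <= v -> v <= x ->
  (\int[mu]_(t in `[u, v]) ((x - t) `^ (- gam))%:E =
    (((x - u) `^ (1 - gam) - (x - v) `^ (1 - gam)) / (1 - gam))%:E)%E.
Proof.
move=> gam1; rewrite le_eqVlt => /predU1P[<- _|uv vx].
  by rewrite set_itv1 integral_set1 subrr mul0r.
have p0 : 0 < 1 - gam by rewrite subr_gt0.
rewrite (@ge0_FTC2_oo _ _ (fun t => - (x - t) `^ (1 - gam) / (1 - gam)))//.
- by congr EFin; field; rewrite gt_eqF.
- by move=> t _; exact: powR_ge0.
- move=> t; rewrite in_itv/= => /andP[ut tv].
  have xt : 0 < x - t by lra.
  apply: (@continuous_comp _ _ _ (fun t => x - t) (@powR R ^~ (- gam))).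
    by apply: cvgB; [exact: cvg_cst|exact: cvg_id].
  apply/differentiable_continuous/derivable1_diffP.
  by apply: derivable_powR; rewrite in_itv/= andbT.
- move=> t; rewrite in_itv/= => /andP[ut tv].
  have xt : 0 < x - t by lra.
  have H := is_derive1_powR (1 - gam) xt.
  have H2 : is_derive t 1 (fun t => x - t) (-1 : R).
    by have := is_deriveB (is_derive_cst x t 1) (is_derive_id t (1 : R)); rewrite sub0r.
  have := @is_derive1_comp _ (@powR R ^~ (1 - gam)) (fun t => x - t) _ _ _ H H2.
  move=> /(is_deriveZ (- (1 - gam)^-1)) => H3.
  have -> : (fun t => - (x - t) `^ (1 - gam) / (1 - gam)) =
     - (1 - gam)^-1 \*: ((@powR R ^~ (1 - gam)) \o (fun t => x - t)).
    by apply/funext => s /=; rewrite /GRing.scale/= mulNr mulrC mulNr.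
  apply: is_derive_eq H3 _; rewrite /GRing.scale/=.
  have -> : 1 - gam - 1 = - gam by ring.
  by field; rewrite gt_eqF.
- have cG : continuous (fun t : R => - (Num.max 0 (x - t)) `^ (1 - gam) / (1 - gam)).
    move=> t; apply: cvgMl; apply: cvgN.
    apply: (@continuous_comp _ _ _ (fun t => x - t)
      (fun s => (Num.max 0 s) `^ (1 - gam))).
      by apply: cvgB; [exact: cvg_cst|exact: cvg_id].
    exact: continuous_powR_max0.
  apply: subspace_eq_continuous (continuous_subspaceT cG) => t.
  rewrite inE/= in_itv/= => /andP[ut tv].
  by rewrite /from_subspace/= (max_idPr _)// subr_ge0 (le_trans tv).
Qed.

Lemma integral_powRBr (gam x u v : R) : gam < 1 -> u <= v -> x <= u ->
  (\int[mu]_(t in `[u, v]) ((t - x) `^ (- gam))%:E =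
    (((v - x) `^ (1 - gam) - (u - x) `^ (1 - gam)) / (1 - gam))%:E)%E.
Proof.
move=> gam1; rewrite le_eqVlt => /predU1P[<- _|uv xu].
  by rewrite set_itv1 integral_set1 subrr mul0r.
have p0 : 0 < 1 - gam by rewrite subr_gt0.
rewrite (@ge0_FTC2_oo _ _ (fun t => (t - x) `^ (1 - gam) / (1 - gam)))//.
- by congr EFin; field; rewrite gt_eqF.
- by move=> t _; exact: powR_ge0.
- move=> t; rewrite in_itv/= => /andP[ut tv].
  have xt : 0 < t - x by lra.
  apply: (@continuous_comp _ _ _ (fun t => t - x) (@powR R ^~ (- gam))).
    by apply: cvgB; [exact: cvg_id|exact: cvg_cst].
  apply/differentiable_continuous/derivable1_diffP.
  by apply: derivable_powR; rewrite in_itv/= andbT.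
- move=> t; rewrite in_itv/= => /andP[ut tv].
  have xt : 0 < t - x by lra.
  have H := is_derive1_powR (1 - gam) xt.
  have H2 : is_derive t 1 (fun t => t - x) (1 : R).
    by have := is_deriveB (is_derive_id t (1 : R)) (is_derive_cst x t 1); rewrite subr0.
  have := @is_derive1_comp _ (@powR R ^~ (1 - gam)) (fun t => t - x) _ _ _ H H2.
  move=> /(is_deriveZ (1 - gam)^-1) => H3.
  have -> : (fun t => (t - x) `^ (1 - gam) / (1 - gam)) =
     (1 - gam)^-1 \*: ((@powR R ^~ (1 - gam)) \o (fun t => t - x)).
    by apply/funext => s /=; rewrite /GRing.scale/= mulrC.
  apply: is_derive_eq H3 _; rewrite /GRing.scale/=.
  have -> : 1 - gam - 1 = - gam by ring.
  by field; rewrite gt_eqF.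
- have cG : continuous (fun t : R => (Num.max 0 (t - x)) `^ (1 - gam) / (1 - gam)).
    move=> t; apply: cvgMl.
    apply: (@continuous_comp _ _ _ (fun t => t - x)
      (fun s => (Num.max 0 s) `^ (1 - gam))).
      by apply: cvgB; [exact: cvg_id|exact: cvg_cst].
    exact: continuous_powR_max0.
  apply: subspace_eq_continuous (continuous_subspaceT cG) => t.
  rewrite inE/= in_itv/= => /andP[ut tv].
  by rewrite /from_subspace/= (max_idPr _)// subr_ge0 (le_trans xu).
Qed.

End power_kernel.

Section bounded_multiplier.
Context d (T : measurableType d) (R : realType) (mu : {measure set T -> \bar R}).

Lemma integrable_mul_bounded (D : set T) (k f : T -> R) (M : R) :
  measurable D -> mu.-integrable D (EFin \o k) -> measurable_fun D f ->
  (forall t, D t -> `|f t| <= M) ->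
  mu.-integrable D (EFin \o (fun t => k t * f t)).
Proof.
move=> mD ik mf fM.
have bf : [bounded f x | x in D].
  exists M; split; first exact: num_real.
  by move=> N /ltW MN t Dt; apply: le_trans (fM _ Dt) MN.
by have := integrableMl mD ik mf bf; apply: eq_integrable.
Qed.

(** Here k and k' stand for kernels with two different base points, A for the part common to both
    integrals and B for the part covered by one only. As k' - k is nonnegative on A and k on B,
    bounding f by M leaves integrals without absolute values, which the explicit formulas
    evaluate. *)
Lemma Rintegral_kernel_diff (A B : set T) (k k' f : T -> R) (M : R) :
  measurable A -> measurable B -> [disjoint A & B] ->
  mu.-integrable (A `|` B) (EFin \o k) -> mu.-integrable A (EFin \o k') ->
  measurable_fun (A `|` B) f -> (forall t, (A `|` B) t -> `|f t| <= M) ->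
  (forall t, B t -> 0 <= k t) -> (forall t, A t -> k t <= k' t) ->
  `|\int[mu]_(t in A `|` B) (k t * f t) - \int[mu]_(t in A) (k' t * f t)| <=
  M * (\int[mu]_(t in A) k' t - \int[mu]_(t in A) k t + \int[mu]_(t in B) k t).
Proof.
move=> mA mB AB ik ik' mf fM k0 kk'.
have mU : measurable (A `|` B) by exact: measurableU.
have sA : A `<=` A `|` B by exact: subsetUl.
have sB : B `<=` A `|` B by exact: subsetUr.
have ikA := integrableS mU mA sA ik.
have ikB := integrableS mU mB sB ik.
have mfA := measurable_funS mU sA mf.
have mfB := measurable_funS mU sB mf.
have fMA t : A t -> `|f t| <= M by move=> /sA; exact: fM.
have fMB t : B t -> `|f t| <= M by move=> /sB; exact: fM.
have ikf := integrable_mul_bounded mU ik mf fM.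
have ikfA := integrable_mul_bounded mA ikA mfA fMA.
have ikfB := integrable_mul_bounded mB ikB mfB fMB.
have ik'fA := integrable_mul_bounded mA ik' mfA fMA.
rewrite Rintegral_setU// addrAC -RintegralB// mulrDr.
apply: le_trans (ler_normD _ _) _; apply: lerD.
  have ikk' : mu.-integrable A (EFin \o (fun t => k' t - k t)).
    by have := integrableB mA ik' ikA; apply: eq_integrable.
  rewrite -RintegralB// -RintegralZl//.
  apply: le_trans (le_normr_Rintegral mA _) _.
    by have := integrableB mA ikfA ik'fA; apply: eq_integrable.
  apply: le_Rintegral => //.
  - apply: integrable_norm.
    by have := integrableB mA ikfA ik'fA; apply: eq_integrable.
  - by have := integrableZl mA M ikk'; apply: eq_integrable.
  - move=> t At /=; rewrite -mulrBl normrM distrC (ger0_norm (_ : 0 <= k' t - k t)) ?subr_ge0 ?kk'//.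
    by rewrite [leLHS]mulrC ler_wpM2r ?subr_ge0 ?kk'// fMA.
rewrite -RintegralZl//.
apply: le_trans (le_normr_Rintegral mB _) _ => //.
apply: le_Rintegral => //.
- exact: integrable_norm.
- by have := integrableZl mB M ikB; apply: eq_integrable.
- move=> t Bt /=; rewrite normrM (ger0_norm (k0 _ Bt)) [leLHS]mulrC.
  by rewrite ler_wpM2r ?k0// fMB.
Qed.

End bounded_multiplier.

Section kernel_integrals.
Variable R : realType.
Notation mu := (@lebesgue_measure R).

Lemma hoelder_continuous (a b p C : R) (F : R -> R) : 0 < p ->
  (forall x y, a <= x -> x < y -> y <= b ->
    `|F y - F x| <= C * (y - x) `^ p) ->
  {within `[a, b], continuous F}.
Proof.
move=> p0 FC; apply/subspace_continuousP => x /=; rewrite in_itv/= => /andP[ax xb].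
have FC' y : a <= y -> y <= b -> `|F x - F y| <= C * (Num.max 0 `|x - y|) `^ p.
  move=> ay yb; rewrite (max_idPr (normr_ge0 _)); case: (ltgtP x y) => [xy|yx|->].
  - rewrite distrC (distrC x) [`|y - x|]gtr0_norm ?subr_gt0//; exact: FC.
  - rewrite [`|x - y|]gtr0_norm ?subr_gt0//; exact: FC.
  - by rewrite !subrr normr0 powR0 ?gt_eqF// mulr0.
apply/cvgrPdist_le => e e0.
have cG : (C * (Num.max 0 `|x - y|) `^ p) @[y --> x] --> (0 : R).
  have cH : continuous (fun y : R => (Num.max 0 `|x - y|) `^ p).
    move=> y; apply: (@continuous_comp _ _ _ (fun y => `|x - y|)
      (fun s => (Num.max 0 s) `^ p)); last exact: continuous_powR_max0.
    by apply: cvg_norm; apply: cvgB; [exact: cvg_cst|exact: cvg_id].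
  rewrite -[X in _ --> X](mulr0 C); apply: cvgMr.
  by have := cH x; rewrite /continuous_at subrr normr0 maxxx powR0 ?gt_eqF//.
have /cvgrPdist_le/(_ _ e0) := cG; rewrite near_withinE.
apply: filterS => y; rewrite sub0r normrN /= in_itv/= => Gy /andP[ay yb].
apply: le_trans (FC' _ ay yb) (le_trans (ler_norm _) Gy).
Qed.

End kernel_integrals.

(** * Fractional integrals *)

Section fractional_integrals.
Variable R : realType.
Notation mu := (@lebesgue_measure R).
Variables (gam : R) (gam0 : 0 <= gam) (gam1 : gam < 1).

Let p0 : 0 < 1 - gam. Proof. by rewrite subr_gt0. Qed.

Lemma measurable_powRBl (x : R) (D : set R) :
  measurable_fun D (fun t => (x - t) `^ (- gam)).
Proof.
apply: measurable_funTS; apply: (measurableT_comp (measurable_powR _)).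
by apply: measurable_funB => //; exact: measurable_cst.
Qed.

Lemma measurable_powRBr (x : R) (D : set R) :
  measurable_fun D (fun t => (t - x) `^ (- gam)).
Proof.
apply: measurable_funTS; apply: (measurableT_comp (measurable_powR _)).
by apply: measurable_funB => //; exact: measurable_cst.
Qed.

Lemma integrable_powRBl (x u v : R) : v <= x ->
  mu.-integrable `[u, v] (EFin \o (fun t => (x - t) `^ (- gam))).
Proof.
move=> vx; have [uv|vu] := leP u v; last first.
  by rewrite set_itv_ge ?bnd_simp -?ltNge//; exact: integrable_set0.
apply/integrableP; split; first by apply/measurable_EFinP; exact: measurable_powRBl.
under eq_integral do rewrite /= ger0_norm ?powR_ge0//.
by rewrite integral_powRBl// ltry.
Qed.

Lemma integrable_powRBr (x u v : R) : x <= u ->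
  mu.-integrable `[u, v] (EFin \o (fun t => (t - x) `^ (- gam))).
Proof.
move=> xu; have [uv|vu] := leP u v; last first.
  by rewrite set_itv_ge ?bnd_simp -?ltNge//; exact: integrable_set0.
apply/integrableP; split; first by apply/measurable_EFinP; exact: measurable_powRBr.
under eq_integral do rewrite /= ger0_norm ?powR_ge0//.
by rewrite integral_powRBr// ltry.
Qed.

Lemma Rintegral_powRBl (x u v : R) : u <= v -> v <= x ->
  \int[mu]_(t in `[u, v]) ((x - t) `^ (- gam)) =
    ((x - u) `^ (1 - gam) - (x - v) `^ (1 - gam)) / (1 - gam).
Proof. by move=> uv vx; rewrite /Rintegral integral_powRBl. Qed.

Lemma Rintegral_powRBr (x u v : R) : u <= v -> x <= u ->
  \int[mu]_(t in `[u, v]) ((t - x) `^ (- gam)) =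
    ((v - x) `^ (1 - gam) - (u - x) `^ (1 - gam)) / (1 - gam).
Proof. by move=> uv vx; rewrite /Rintegral integral_powRBr. Qed.

Variables (a b M : R) (f : R -> R).
Hypothesis mf : measurable_fun setT f.
Hypothesis fM : forall t, t \in `[a, b] -> `|f t| <= M.

Lemma integrable_left_kernel (x : R) : x <= b ->
  mu.-integrable `[a, x] (EFin \o left_kernel gam f x).
Proof.
move=> xb; apply: (integrable_mul_bounded _ (M := M)).
- exact: measurable_itv.
- exact: integrable_powRBl.
- exact: measurable_funTS.
- move=> t /=; rewrite in_itv/= => /andP[at_ tx].
  by apply: fM; rewrite in_itv/= at_ (le_trans tx).
Qed.

Lemma integrable_right_kernel (x : R) : a <= x ->
  mu.-integrable `[x, b] (EFin \o right_kernel gam f x).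
Proof.
move=> ax; apply: (integrable_mul_bounded _ (M := M)).
- exact: measurable_itv.
- exact: integrable_powRBr.
- exact: measurable_funTS.
- move=> t /=; rewrite in_itv/= => /andP[xt tb].
  by apply: fM; rewrite in_itv/= tb (le_trans ax).
Qed.

Let powRN_anti (s t : R) : 0 < s -> s <= t -> t `^ (- gam) <= s `^ (- gam).
Proof.
move=> s0 st; have t0 := lt_le_trans s0 st.
rewrite !powRN lef_pV2 ?posrE ?powR_gt0//.
by rewrite ge0_ler_powR// nnegrE ltW.
Qed.

Let powR_mono (s t : R) : 0 <= s -> s <= t -> s `^ (1 - gam) <= t `^ (1 - gam).
Proof.
move=> s0 st; apply: ge0_ler_powR; rewrite ?nnegrE// ?(ltW p0)//.
exact: le_trans st.
Qed.

(** Moving the base point from x to y > x changes the kernel on [a, x] and adds the piece [x, y];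
    both effects are of order (y - x)^(1 - gam). Order gam = 0 is included because [potential]
    contains an ordinary integral. *)
Lemma left_integral_continuous :
  {within `[a, b], continuous (left_integral a gam f)}.
Proof.
apply: (@hoelder_continuous _ _ _ _ (M * 2 / (1 - gam)) _ p0) => x y ax xy yb.
have M0 : 0 <= M.
  by apply: le_trans (fM (t := a) _); rewrite ?in_itv/= ?lexx ?(le_trans ax) ?(le_trans (ltW xy)).
have iy := integrable_powRBl a (lexx y).
have iax : mu.-integrable `[a, x[ (EFin \o (fun t => (x - t) `^ (- gam))).
  apply: integrableS (integrable_powRBl a (lexx x)) => //.
  exact: subset_itv_co_cc.
have iay : mu.-integrable `[a, x[ (EFin \o (fun t => (y - t) `^ (- gam))).
  apply: integrableS iy => //.
  by apply: subset_itvl; rewrite bnd_simp ltW.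
have iax' : mu.-integrable `[a, x[ (EFin \o (fun t => (x - t) `^ (- gam) * f t)).
  apply: integrableS (integrable_left_kernel (ltW (lt_le_trans xy yb))) => //.
  exact: subset_itv_co_cc.
(* The point x is dropped from the first piece: comparing the two kernels requires x - t > 0. *)
rewrite /left_integral /left_kernel -(Rintegral_itv_bndo_bndc iax').
have E : `[a, y]%classic = `[a, x[%classic `|` `[x, y]%classic.
  by apply: itv_bndbnd_setU; rewrite bnd_simp// ltW.
rewrite E.
apply: le_trans.
  apply: (Rintegral_kernel_diff (M := M)) => //; rewrite -?E//.
  - apply/disj_setPS => t [] /=; rewrite !in_itv/= => /andP[_ tx] /andP[xt _].
    by have := lt_le_trans tx xt; rewrite ltxx.
  - exact: measurable_funTS.
  - move=> t /=; rewrite in_itv/= => /andP[? ty].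
    by apply: fM; rewrite in_itv/=; apply/andP; split => //; exact: le_trans yb.
  - by move=> t _; exact: powR_ge0.
  - move=> t /=; rewrite in_itv/= => /andP[? tx]; apply: powRN_anti; lra.
rewrite !Rintegral_itv_bndo_bndc// !Rintegral_powRBl ?(ltW xy)//.
rewrite !subrr powR0 ?gt_eqF//.
(* Each piece contributes (y - x)^(1 - gam) once, whence the factor 2; what remains is a difference
   of powers of the favourable sign. *)
rewrite -subr_ge0 (_ : _ - _ = M / (1 - gam) *
  ((y - a) `^ (1 - gam) - (x - a) `^ (1 - gam))); last by ring.
apply: mulr_ge0; first by rewrite divr_ge0 ?(ltW p0).
by rewrite subr_ge0; apply: powR_mono; lra.
Qed.

Lemma right_integral_continuous :
  {within `[a, b], continuous (right_integral b gam f)}.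
Proof.
apply: (@hoelder_continuous _ _ _ _ (M * 2 / (1 - gam)) _ p0) => x y ax xy yb.
have M0 : 0 <= M.
  by apply: le_trans (fM (t := a) _); rewrite ?in_itv/= ?lexx ?(le_trans ax) ?(le_trans (ltW xy)).
have ix := integrable_powRBr b (lexx x).
have iyb : mu.-integrable `]y, b] (EFin \o (fun t => (t - y) `^ (- gam))).
  apply: integrableS (integrable_powRBr b (lexx y)) => //.
  exact: subset_itv_oc_cc.
have ixb : mu.-integrable `]y, b] (EFin \o (fun t => (t - x) `^ (- gam))).
  apply: integrableS ix => //.
  by apply: subset_itvr; rewrite bnd_simp ltW.
have iyb' : mu.-integrable `]y, b] (EFin \o (fun t => (t - y) `^ (- gam) * f t)).
  apply: integrableS (integrable_right_kernel (ltW (le_lt_trans ax xy))) => //.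
  exact: subset_itv_oc_cc.
rewrite distrC /right_integral /right_kernel -(Rintegral_itv_obnd_cbnd iyb').
have E : `[x, b]%classic = `]y, b]%classic `|` `[x, y]%classic.
  by rewrite setUC; apply: itv_bndbnd_setU; rewrite bnd_simp// ltW.
rewrite E.
apply: le_trans.
  apply: (Rintegral_kernel_diff (M := M)) => //; rewrite -?E//.
  - apply/disj_setPS => t [] /=; rewrite !in_itv/= => /andP[ty _] /andP[_ yt].
    by have := lt_le_trans ty yt; rewrite ltxx.
  - exact: measurable_funTS.
  - move=> t /=; rewrite in_itv/= => /andP[xt ?].
    by apply: fM; rewrite in_itv/=; apply/andP; split => //; exact: le_trans xt.
  - by move=> t _; exact: powR_ge0.
  - move=> t /=; rewrite in_itv/= => /andP[? tx]; apply: powRN_anti; lra.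
rewrite !Rintegral_itv_obnd_cbnd// !Rintegral_powRBr ?(ltW xy)//.
rewrite !subrr powR0 ?gt_eqF//.
rewrite -subr_ge0 (_ : _ - _ = M / (1 - gam) *
  ((b - x) `^ (1 - gam) - (b - y) `^ (1 - gam))); last by ring.
apply: mulr_ge0; first by rewrite divr_ge0 ?(ltW p0).
by rewrite subr_ge0; apply: powR_mono; lra.
Qed.

End fractional_integrals.

(** * Fractional integration by parts *)

Section fractional_fubini.
Variable R : realType.
Notation mu := (@lebesgue_measure R).
Variables (gam : R) (gam1 : gam < 1).
Variables (a b M N : R) (f phi : R -> R).
Hypotheses (mf : measurable_fun setT f) (mphi : measurable_fun setT phi).
Hypothesis fM : forall t, t \in `[a, b] -> `|f t| <= M.
Hypothesis phiN : forall t, t \in `[a, b] -> `|phi t| <= N.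

(** The integrand of the double integral, with x = z.1 and t = z.2, extended by 0 off the triangle a
    <= t <= x <= b. Fubini can then run over the whole plane, each slice carrying its own limits of
    integration. *)
Let H (z : measurableTypeR R * measurableTypeR R) : R :=
  if [&& a <= z.2, z.2 <= z.1 & z.1 <= b]
  then (z.1 - z.2) `^ (- gam) * phi z.1 * f z.2 else 0.

Let mH : measurable_fun setT H.
Proof.
apply: measurable_fun_ifT.
- apply: measurable_and.
    by apply: measurable_fun_ler; [exact: measurable_cst|exact: measurable_snd].
  apply: measurable_and.
    by apply: measurable_fun_ler; [exact: measurable_snd|exact: measurable_fst].
  by apply: measurable_fun_ler; [exact: measurable_fst|exact: measurable_cst].
- apply: measurable_funM; last exact: (measurableT_comp mf measurable_snd).
  apply: measurable_funM; last exact: (measurableT_comp mphi measurable_fst).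
  apply: (measurableT_comp (measurable_powR _)).
  by apply: measurable_funB; [exact: measurable_fst|exact: measurable_snd].
- exact: measurable_cst.
Qed.

Let H1 (x : R) : (fun t => (H (x, t))%:E) =
  (fun t => (phi x * left_kernel gam f x t)%:E) \_ (if x <= b then `[a, x]%classic else set0).
Proof.
apply/funext => t; rewrite /H patchE /=.
case: ifPn => [/and3P[at_ tx ->]|].
  rewrite mem_set/= ?in_itv/= ?at_//; congr EFin.
  by rewrite /left_kernel; ring.
rewrite !negb_and => h.
case: ifPn => // /set_mem; case: ifPn => // xb /=; rewrite in_itv/= => /andP[at_ tx].
by move: h; rewrite at_ tx xb.
Qed.

Let H2 (t : R) : (fun x => (H (x, t))%:E) =
  (fun x => (f t * right_kernel gam phi t x)%:E) \_ (if a <= t then `[t, b]%classic else set0).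
Proof.
apply/funext => x; rewrite /H patchE /=.
case: ifPn => [/and3P[-> tx xb]|].
  rewrite mem_set/= ?in_itv/= ?tx//; congr EFin.
  by rewrite /right_kernel; ring.
rewrite !negb_and => h.
case: ifPn => // /set_mem; case: ifPn => // at_ /=; rewrite in_itv/= => /andP[tx xb].
by move: h; rewrite at_ tx xb.
Qed.

Let iH1 (x : R) : (\int[mu]_t (H (x, t))%:E =
  ((fun x => (phi x * left_integral a gam f x)%:E) \_ `[a, b]) x)%E.
Proof.
rewrite H1 -integral_mkcond patchE; case: ifPn => xb; last first.
  rewrite integral_set0 memNset//= in_itv/= => /andP[_ bx].
  by rewrite bx in xb.
case: ifPn => [_|xab].
  rewrite /left_integral EFinM /Rintegral fineK; last first.
    by apply: integrable_fin_num => //; exact: (integrable_left_kernel gam1 mf fM).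
  under eq_integral do rewrite EFinM.
  by rewrite integralZl//; exact: (integrable_left_kernel gam1 mf fM).
rewrite set_itv_ge ?integral_set0// bnd_simp; apply/negP => ax.
by move/negP: xab; apply; rewrite mem_set//= in_itv/= ax.
Qed.

Let iH2 (t : R) : (\int[mu]_x (H (x, t))%:E =
  ((fun t => (f t * right_integral b gam phi t)%:E) \_ `[a, b]) t)%E.
Proof.
rewrite H2 -integral_mkcond patchE; case: ifPn => xb; last first.
  rewrite integral_set0 memNset//= in_itv/= => /andP[bx _].
  by rewrite bx in xb.
case: ifPn => [_|xab].
  rewrite /right_integral EFinM /Rintegral fineK; last first.
    by apply: integrable_fin_num => //; exact: (integrable_right_kernel gam1 mphi phiN).
  under eq_integral do rewrite EFinM.
  by rewrite integralZl//; exact: (integrable_right_kernel gam1 mphi phiN).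
rewrite set_itv_ge ?integral_set0// bnd_simp; apply/negP => ax.
by move/negP: xab; apply; rewrite mem_set//= in_itv/= ax xb.
Qed.

Let iH : (mu \x mu)%E.-integrable setT (EFin \o H).
Proof.
apply/integrable12ltyP; first exact/measurable_EFinP.
(* If [a, b] is empty the bounds M and N may be negative, hence the absolute values. The last factor
   is the integral of the kernel over the full length b - a, which dominates the inner integrals. *)
pose K := `|N| * `|M| * ((b - a) `^ (1 - gam) / (1 - gam)).
have HK (x : R) : (\int[mu]_t `|(EFin \o H) (x, t)| <= (K * \1_`[a, b] x)%:E)%E.
  have -> : (fun t => `|(EFin \o H) (x, t)|)%E =
      (fun t => `|(phi x * left_kernel gam f x t)%:E|%E) \_
        (if x <= b then `[a, x]%classic else set0).
    apply/funext => t.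
    have Ht : (H (x, t))%:E = _ := congr1 (fun h => h t) (H1 x).
    transitivity (`|(H (x, t))%:E|%E); first by [].
    by rewrite Ht !patchE; case: ifP => //= _; rewrite normr0.
  rewrite -integral_mkcond; case: ifPn => xb; last first.
    rewrite integral_set0 lee_fin mulr_ge0// /K !mulr_ge0// ?powR_ge0//.
    by rewrite invr_ge0 subr_ge0 ltW.
  have [ax|xa] := leP a x; last first.
    rewrite set_itv_ge ?bnd_simp -?ltNge//.
    rewrite integral_set0 lee_fin mulr_ge0// /K !mulr_ge0// ?powR_ge0//.
    by rewrite invr_ge0 subr_ge0 ltW.
  rewrite indicE mem_set/= ?in_itv/= ?ax// mulr1.
  apply: (@le_trans _ _ (\int[mu]_(t in `[a, x]) (`|N| * `|M| * (x - t) `^ (- gam))%:E)%E).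
    apply: ge0_le_integral => //.
    - apply/measurable_EFinP; apply: measurableT_comp => //.
      apply: measurable_funM; first exact: measurable_cst.
      apply: measurable_funM; first exact: measurable_powRBl.
      exact: measurable_funTS.
    - apply/measurable_EFinP.
      by apply: measurable_funM; [exact: measurable_cst|exact: measurable_powRBl].
    - move=> t /=; rewrite in_itv/= => /andP[at_ tx]; rewrite lee_fin.
      rewrite /left_kernel !normrM (ger0_norm (powR_ge0 _ _)).
      have fM' : `|f t| <= `|M|.
        by apply: le_trans (fM _) (ler_norm _); rewrite in_itv/= at_ (le_trans tx).
      have phiN' : `|phi x| <= `|N|.
        by apply: le_trans (phiN _) (ler_norm _); rewrite in_itv/= ax.
      rewrite mulrCA [leRHS]mulrC ler_wpM2l ?powR_ge0//.
      exact: ler_pM.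
  under eq_integral do rewrite EFinM.
  rewrite integralZl//; last exact: integrable_powRBl.
  rewrite integral_powRBl// -EFinM lee_fin /K ler_wpM2l//.
  rewrite ler_wpM2r ?invr_ge0 ?subr_ge0 ?(ltW gam1)// subrr.
  apply: (@le_trans _ _ ((x - a) `^ (1 - gam))).
    by rewrite gerBl powR_ge0.
  apply: ge0_ler_powR; rewrite ?nnegrE ?subr_ge0 ?(ltW gam1)//.
  - exact: le_trans xb.
  - by rewrite lerD2r.
apply: (@le_lt_trans _ _ (\int[mu]_x (K * \1_`[a, b] x)%:E)%E).
  apply: ge0_le_integral => //.
  - by move=> x _; exact: integral_ge0.
  - apply: (measurable_fun_fubini_tonelli_F (abse \o (EFin \o H))) => //.
      by apply: measurableT_comp => //; exact/measurable_EFinP.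
    by move=> x; exact: abse_ge0.
  - apply/measurable_EFinP; apply: measurable_funM => //.
under eq_integral do rewrite EFinM.
rewrite integralZl//; last exact: integrable_indic_itv.
rewrite integral_indic// setIT.
suff : (K%:E * mu `[a, b]%classic < +oo)%E by [].
rewrite lebesgue_measure_itv/=.
by case: ifP => _; rewrite ?mule0 ?ltry// -EFinB -EFinM ltry.
Qed.

(** Both sides are iterated integrals of [H], taken in the two orders. *)
Lemma Rintegral_left_right :
  \int[mu]_(x in `[a, b]) (phi x * left_integral a gam f x) =
  \int[mu]_(t in `[a, b]) (f t * right_integral b gam phi t).
Proof.
have := Fubini iH; rewrite /=.
under eq_integral do rewrite iH1.
rewrite -integral_mkcond => E.
rewrite [LHS]/Rintegral E.
under eq_integral do rewrite iH2.
by rewrite -integral_mkcond.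
Qed.

End fractional_fubini.

(** * Integral functionals *)

Section smooth_lagrangian.
Variable R : realType.
Notation mu := (@lebesgue_measure R).

(** By the mean value theorem the error is (f' z - c) h for some z between s and s + h. The slope c
    is free and need not be f' s, which [continuous_joint] exploits. *)
Lemma mvt_estimate (f : R -> R) (s h c e : R) :
  (forall t, derivable f t 1) ->
  (forall k, `|k| <= `|h| -> `|derive1 f (s + k) - c| <= e) ->
  `|f (s + h) - f s - c * h| <= e * `|h|.
Proof.
move=> df fe.
have cf : continuous f.
  by move=> t; apply/differentiable_continuous/derivable1_diffP.
have H x y : x <= y -> exists2 z, z \in `[x, y] & f y - f x = derive1 f z * (y - x).
  move=> xy; apply: MVT_segment => //; last exact: continuous_subspaceT.
  by move=> t _; rewrite derive1E; exact/derivableP.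
have [h0|h0] := leP 0 h.
  have [|z zs E] := H s (s + h); first by rewrite lerDl.
  rewrite E (_ : _ - _ = (derive1 f z - c) * h); last by ring.
  rewrite normrM ler_wpM2r//.
  have -> : z = s + (z - s) by ring.
  apply: fe; move: zs; rewrite in_itv/= => /andP[z1 z2].
  by rewrite !ger0_norm//; lra.
have [|z zs E] := H (s + h) s; first by rewrite gerDl ltW.
rewrite (_ : _ - _ = (derive1 f z - c) * h); last by rewrite -[_ - f s]opprB E; ring.
rewrite normrM ler_wpM2r//.
have -> : z = s + (z - s) by ring.
apply: fe; move: zs; rewrite in_itv/= => /andP[z1 z2].
by rewrite [leLHS]ler0_norm ?ltr0_norm//; lra.
Qed.

Lemma weighted_sum_le (p2 p3 p4 q2 q3 q4 q : R) :
  q2 <= q -> q3 <= q -> q4 <= q ->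
  p2 * q2 <= p2 * q -> p3 * q3 <= p3 * q -> p4 * q4 <= p4 * q ->
  q2 + q3 + q4 + (p2 * q2 + p3 * q3 + p4 * q4) <= (p2 + p3 + p4 + 3) * q.
Proof. lra. Qed.

Definition joint (L : R -> R -> R -> R -> R) (p : R * R * R * R) : R :=
  L p.1.1.1 p.1.1.2 p.1.2 p.2.

Lemma continuous_joint_comp (G : R -> R -> R -> R -> R) (s y u v : R -> R) :
  continuous (joint G) -> continuous s -> continuous y -> continuous u ->
  continuous v -> continuous (fun x => G (s x) (y x) (u x) (v x)).
Proof.
move=> cG cs cy cu cv x.
apply: (@continuous_comp _ _ _ (fun x => (s x, y x, u x, v x)) (joint G)); last exact: cG.
apply: (@cvg_pair _ _ _ _ (nbhs (s x, y x, u x)) (nbhs (v x))) => //; last exact: cv.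
apply: (@cvg_pair _ _ _ _ (nbhs (s x, y x)) (nbhs (u x))) => //; last exact: cu.
by apply: (@cvg_pair _ _ _ _ (nbhs (s x)) (nbhs (y x))) => //; [exact: cs|exact: cy].
Qed.

(** A Heine argument: continuity of G gives a radius at each point of the curve (x, y x, u x, v x),
    and compactness of [a, b], in its covering form, turns these radii into a single d. *)
Lemma joint_uniform_continuous (a b : R) (G : R -> R -> R -> R -> R)
    (y u v : R -> R) (e : R) :
  continuous (joint G) -> continuous y -> continuous u -> continuous v ->
  0 < e -> exists2 d : R, 0 < d & forall x h k m, x \in `[a, b] ->
    `|h| <= d -> `|k| <= d -> `|m| <= d ->
    `|G x (y x + h) (u x + k) (v x + m) - G x (y x) (u x) (v x)| <= e.
Proof.
move=> cG cy cu cv e0.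
have e20 : 0 < e / 2 by lra.
have : \forall d \near (0 : R)^'+, `[a, b]%classic `<=` [set x |
   forall h k m, `|h| <= d -> `|k| <= d -> `|m| <= d ->
    `|G x (y x + h) (u x + k) (v x + m) - G x (y x) (u x) (v x)| <= e].
  have /compact_near_coveringP cK := @segment_compact R a b.
  apply: (cK _ (0 : R)^'+) => x _.
  have := cG (x, y x, u x, v x); move/cvgrPdist_lt/(_ _ e20).
  move=> /nbhs_ballP[r /= r0 rG].
  have r20 : 0 < r / 2 by lra.
  have /cvgrPdist_lt/(_ _ r20) hy := cy x.
  have /cvgrPdist_lt/(_ _ r20) hu := cu x.
  have /cvgrPdist_lt/(_ _ r20) hv := cv x.
  have hx : \forall t \near x, `|x - t| < r / 2.
    by apply/nbhs_ballP; exists (r / 2).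
  near=> x' d => h k m hd kd md.
  have dr : d < r / 2 by near: d; exact: nbhs_right_lt.
  have x1 : `|x - x'| < r / 2 by near: x'.
  have x2 : `|y x - y x'| < r / 2 by near: x'.
  have x3 : `|u x - u x'| < r / 2 by near: x'.
  have x4 : `|v x - v x'| < r / 2 by near: x'.
  have B (p q j : R) : `|p - q| < r / 2 -> `|j| <= d -> `|p - (q + j)| < r.
    move=> pq jd; rewrite opprD addrA; apply: le_lt_trans (ler_normB _ _) _.
    by lra.
  have rr : r / 2 < r by lra.
  have xr := lt_trans x1 rr.
  have h1 := rG (x', y x' + h, u x' + k, v x' + m).
  have h2 := rG (x', y x', u x', v x').
  (* Both values are compared with the one at the centre x of the neighbourhood. *)
  rewrite -(subrKA (G x (y x) (u x) (v x))) addrC.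
  apply: le_trans (ler_normD _ _) _; rewrite [leRHS](splitr e).
  apply: lerD; apply: ltW.
    by apply: h2; do 3?split; rewrite /ball/=;
      [exact: xr|exact: lt_trans x2 rr|exact: lt_trans x3 rr|exact: lt_trans x4 rr].
  by rewrite distrC; apply: h1; do 3?split => //=; exact: B.
move=> [d d0 H]; exists (d / 2); first by rewrite /= in d0; lra.
move=> x h k m xab; apply: (H (d / 2)) => //=.
- by rewrite sub0r normrN gtr0_norm; rewrite /= in d0; lra.
- by rewrite /= in d0; lra.
Unshelve. all: by end_near. Qed.

Variable L : R -> R -> R -> R -> R.
Hypothesis dL2 : forall x y u v, derivable (fun s => L x s u v) y 1.
Hypothesis dL3 : forall x y u v, derivable (fun s => L x y s v) u 1.
Hypothesis dL4 : forall x y u v, derivable (fun s => L x y u s) v 1.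

(** One variable is moved at a time, y first with u + k and v + m already in place, so that each
    step is a one-variable estimate at points covered by the hypothesis. *)
Lemma mvt_estimate3 (x y u v h k m c2 c3 c4 e : R) :
  (forall h' k' m', `|h'| <= `|h| -> `|k'| <= `|k| -> `|m'| <= `|m| ->
    [/\ `|partial2 L x (y + h') (u + k') (v + m') - c2| <= e,
        `|partial3 L x (y + h') (u + k') (v + m') - c3| <= e &
        `|partial4 L x (y + h') (u + k') (v + m') - c4| <= e]) ->
  `|L x (y + h) (u + k) (v + m) - L x y u v - (c2 * h + c3 * k + c4 * m)|
    <= e * (`|h| + `|k| + `|m|).
Proof.
move=> H.
have H2 := @mvt_estimate (fun s => L x s (u + k) (v + m)) y h c2 e
  (fun t => @dL2 x t (u + k) (v + m)).
have H3 := @mvt_estimate (fun s => L x y s (v + m)) u k c3 e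
  (fun t => @dL3 x y t (v + m)).
have H4 := @mvt_estimate (fun s => L x y u s) v m c4 e (fun t => @dL4 x y u t).
have {}H2 := H2 (fun h' hh => let: And3 q _ _ := H h' k m hh (lexx _) (lexx _) in q).
have {}H3 : `|L x y (u + k) (v + m) - L x y u (v + m) - c3 * k| <= e * `|k|.
  apply: H3 => k' kk.
  have h0 : `|0 : R| <= `|h| by rewrite normr0.
  by have [_] := H 0 k' m h0 kk (lexx _); rewrite addr0.
have {}H4 : `|L x y u (v + m) - L x y u v - c4 * m| <= e * `|m|.
  apply: H4 => m' mm.
  have h0 : `|0 : R| <= `|h| by rewrite normr0.
  have k0 : `|0 : R| <= `|k| by rewrite normr0.
  by have [_ _] := H 0 0 m' h0 k0 mm; rewrite !addr0.
rewrite (_ : _ - _ - _ =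
  (L x (y + h) (u + k) (v + m) - L x y (u + k) (v + m) - c2 * h) +
  (L x y (u + k) (v + m) - L x y u (v + m) - c3 * k) +
  (L x y u (v + m) - L x y u v - c4 * m)); last by ring.
rewrite !mulrDr; apply: le_trans (ler_normD _ _) (lerD _ H4).
exact: le_trans (ler_normD _ _) (lerD H2 H3).
Qed.

Hypothesis cL2 : continuous (joint (partial2 L)).
Hypothesis cL3 : continuous (joint (partial3 L)).
Hypothesis cL4 : continuous (joint (partial4 L)).

(** Near p the last three partial derivatives are bounded, so L x' is Lipschitz in (y, u, v) with a
    constant that does not depend on x' near x; continuity in x alone then suffices. *)
Lemma continuous_joint : (forall y u v, continuous (fun x => L x y u v)) ->
  continuous (joint L).
Proof.
move=> cL1 p; apply/cvgrPdist_le => e e0 /=.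
pose x : R := p.1.1.1; pose y : R := p.1.1.2; pose u : R := p.1.2; pose v : R := p.2.
(* Close to p each partial derivative is within 1 of its value at p; the 3 collects these three
   errors. *)
pose C := `|partial2 L x y u v| + `|partial3 L x y u v| + `|partial4 L x y u v| + 3.
have C0 : 0 < C by rewrite /C; do !rewrite ltr_wpDl ?addr_ge0//.
have /cvgrPdist_le/(_ _ ltr01)/nbhs_ballP[r2 /= r20 R2] := @cL2 p.
have /cvgrPdist_le/(_ _ ltr01)/nbhs_ballP[r3 /= r30 R3] := @cL3 p.
have /cvgrPdist_le/(_ _ ltr01)/nbhs_ballP[r4 /= r40 R4] := @cL4 p.
have e20 : 0 < e / 2 by lra.
have /cvgrPdist_le/(_ _ e20)/nbhs_ballP[r1 /= r10 R1] := cL1 y u v x.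
have eC0 : 0 < e / (2 * C) by rewrite divr_gt0 ?mulr_gt0.
pose r := Num.min (Num.min r1 r2) (Num.min (Num.min r3 r4) (e / (2 * C))).
have r0 : 0 < r by rewrite !lt_min r10 r20 r30 r40.
apply/(@nbhs_ballP R (R * R * R * R)%type); exists r => //= -[[[x' y'] u'] v'] [[[/= bx by_] bu] bv].
move: bx by_ bu bv; rewrite /ball/= !lt_min => /andP[/andP[x1 x2] /andP[/andP[x3 x4] x5]].
move=> /andP[/andP[y1 y2] /andP[/andP[y3 y4] y5]].
move=> /andP[/andP[u1 u2] /andP[/andP[u3 u4] u5]].
move=> /andP[/andP[v1 v2] /andP[/andP[v3 v4] v5]].
have := @mvt_estimate3 x' y u v (y' - y) (u' - u) (v' - v)
  (partial2 L x y u v) (partial3 L x y u v) (partial4 L x y u v) 1.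
have bb (w w' h j : R) : `|w - w'| < j -> `|h| <= `|w' - w| -> `|w - (w + h)| < j.
  by move=> wj hw; rewrite opprD addrA subrr sub0r normrN (le_lt_trans hw)// distrC.
have -> : y + (y' - y) = y' by ring.
have -> : u + (u' - u) = u' by ring.
have -> : v + (v' - v) = v' by ring.
move=> /(_ _)/wrap[h k m hh kk mm|E].
  split; rewrite distrC.
  - by apply: (R2 (x', y + h, u + k, v + m)); do 3?split => //=; apply: bb; eassumption.
  - by apply: (R3 (x', y + h, u + k, v + m)); do 3?split => //=; apply: bb; eassumption.
  - by apply: (R4 (x', y + h, u + k, v + m)); do 3?split => //=; apply: bb; eassumption.
have E1 := R1 x' x1.
rewrite /joint/=.
set A := L x' y' u' v' in E *.
have T : `|L x' y u v - A| <= e / 2.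
  rewrite distrC.
  rewrite -(subrK (partial2 L x y u v * (y' - y) + partial3 L x y u v * (u' - u) +
     partial4 L x y u v * (v' - v)) (A - _)).
  apply: le_trans (ler_normD _ _) _.
  apply: le_trans (lerD E _) _.
    apply: le_trans (ler_normD _ _) (lerD (le_trans (ler_normD _ _) (lexx _)) (lexx _)).
  rewrite !normrM mul1r.
  apply: (@le_trans _ _ (C * (e / (2 * C)))); last first.
    by rewrite le_eqVlt; apply/orP; left; apply/eqP; field; rewrite gt_eqF.
  have le1 : `|y' - y| <= e / (2 * C) by rewrite distrC ltW.
  have le2 : `|u' - u| <= e / (2 * C) by rewrite distrC ltW.
  have le3 : `|v' - v| <= e / (2 * C) by rewrite distrC ltW.
  have M1 := ler_wpM2l (normr_ge0 (partial2 L x y u v)) le1.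
  have M2 := ler_wpM2l (normr_ge0 (partial3 L x y u v)) le2.
  have M3 := ler_wpM2l (normr_ge0 (partial4 L x y u v)) le3.
  exact: (weighted_sum_le le1 le2 le3 M1 M2 M3).
rewrite -(subrKA (L x' y u v)) [leRHS](splitr e).
exact: le_trans (ler_normD _ _) (lerD E1 T).
Qed.

End smooth_lagrangian.

(** * First variation of an integral functional *)

Section integral_functional.
Variable R : realType.
Notation mu := (@lebesgue_measure R).

Definition smooth (L : R -> R -> R -> R -> R) : Prop :=
  [/\ continuous (joint L),
      forall x y u v, derivable (fun s => L x s u v) y 1,
      forall x y u v, derivable (fun s => L x y s v) u 1 &
      forall x y u v, derivable (fun s => L x y u s) v 1] /\
  [/\ continuous (joint (partial2 L)), continuous (joint (partial3 L)) &
      continuous (joint (partial4 L))].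

Lemma continuous_joint_clamp (a b : R) (G : R -> R -> R -> R -> R) : a <= b ->
  continuous_on_slab a b G -> continuous (joint (fun x => G (clamp a b x))).
Proof.
move=> ab cG.
have cp : continuous (fun p : R * R * R * R => (clamp a b p.1.1.1, p.1.1.2, p.1.2, p.2)).
  move=> p.
  apply: (@cvg_pair _ _ _ _ (nbhs (clamp a b p.1.1.1, p.1.1.2, p.1.2)) (nbhs p.2)) => //; last exact: cvg_snd.
  apply: (@cvg_pair _ _ _ _ (nbhs (clamp a b p.1.1.1, p.1.1.2)) (nbhs p.1.2)) => //.
    apply: (@cvg_pair _ _ _ _ (nbhs (clamp a b p.1.1.1)) (nbhs p.1.1.2)) => //.
      apply: (@continuous_comp _ _ _ (fun p : R * R * R * R => p.1.1.1) (clamp a b)); last exact: continuous_clamp.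
      apply: (@continuous_comp _ _ _ (fun p : R * R * R * R => p.1.1) fst); last exact: cvg_fst.
      by apply: (@continuous_comp _ _ _ (fun p : R * R * R * R => p.1) fst); exact: cvg_fst.
    apply: (@continuous_comp _ _ _ (fun p : R * R * R * R => p.1.1) snd); last exact: cvg_snd.
    by apply: (@continuous_comp _ _ _ (fun p : R * R * R * R => p.1) fst); exact: cvg_fst.
  by apply: (@continuous_comp _ _ _ (fun p : R * R * R * R => p.1) snd); [exact: cvg_fst|exact: cvg_snd].
have := continuous_within_comp cG cp; apply => p /=; exact: clamp_in.
Qed.

Lemma derivable_on_itv_cvg (a b : R) (f : R -> R) (x : R) :
  derivable_on_itv a b f x -> f @ within `[a, b] (nbhs x) --> f x.
Proof.
move=> /cvg_ex[/= l fl].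
have H : (fun t => (f t - f x) / (t - x) * (t - x) + f x) @ within `[a, b] x^' --> f x.
  rewrite -[X in _ --> X]add0r -[X in _ --> X + _](mulr0 l).
  apply: cvgD; last exact: cvg_cst.
  apply: cvgM => //.
  rewrite -[X in _ --> X](subrr x); apply: cvgB; last exact: cvg_cst.
  by apply: cvg_trans (cvg_within _) _; exact: cvg_within.
apply/cvgrPdist_le => e e0; have /cvgrPdist_le/(_ _ e0) := H.
rewrite !near_withinE => /filterS; apply => t /=.
have [-> _ _|tx /(_ isT) h tab] := eqVneq t x; first by rewrite subrr normr0 ltW.
by have := h tab; rewrite mulfVK ?subr_eq0// subrK.
Qed.

Lemma C1_smooth (a b : R) (L : R -> R -> R -> R -> R) : a <= b ->
  C1_on_slab a b L -> smooth (fun x => L (clamp a b x)).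
Proof.
move=> ab [dL [_ c2 c3 c4]].
have d x y u v := dL (clamp a b x) y u v (clamp_in x ab).
have H2 : continuous (joint (partial2 (fun x => L (clamp a b x)))).
  exact: continuous_joint_clamp c2.
have H3 : continuous (joint (partial3 (fun x => L (clamp a b x)))).
  exact: continuous_joint_clamp c3.
have H4 : continuous (joint (partial4 (fun x => L (clamp a b x)))).
  exact: continuous_joint_clamp c4.
split; split => //; try by move=> x y u v; case: (d x y u v).
apply: continuous_joint => //; try by move=> x y u v; case: (d x y u v).
move=> y u v.
apply: (@continuous_clamp_comp _ _ a b (fun x => L x y u v)) => //.
apply/subspace_continuousP => x xab.
apply: derivable_on_itv_cvg.
by have [D1 _ _ _] := dL x y u v xab; exact: D1.
Qed.

(** The function and its two Caputo derivatives enter as three unrelated functions, so that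
    differentiating the functional involves no fractional calculus. *)
Definition functional4 (a b : R) (L : R -> R -> R -> R -> R) (y u v : R -> R) :=
  \int[mu]_(x in `[a, b]) L x (y x) (u x) (v x).

Definition variation (a b : R) (L : R -> R -> R -> R -> R) (y u v h k m : R -> R) :=
  \int[mu]_(x in `[a, b]) (partial2 L x (y x) (u x) (v x) * h x +
    partial3 L x (y x) (u x) (v x) * k x + partial4 L x (y x) (u x) (v x) * m x).

Lemma continuous_integrable_itv (a b : R) (f : R -> R) : continuous f ->
  mu.-integrable `[a, b] (EFin \o f).
Proof.
move=> cf; apply: continuous_compact_integrable; first exact: segment_compact.
exact: continuous_subspaceT.
Qed.

Lemma continuous_bounded_itv (a b : R) (f : R -> R) : continuous f ->
  exists M, forall t, t \in `[a, b] -> `|f t| <= M.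
Proof.
move=> cf; have [ab|ba] := leP a b; last first.
  by exists 0 => t; rewrite in_itv/= => /andP[h /(le_trans h)]; rewrite leNgt ba.
have cf' : {within `[a, b], continuous (fun t => `|f t|)}.
  by apply: continuous_subspaceT => t; apply: cvg_norm; exact: cf.
by have [c _ H] := EVT_max ab cf'; exists `|f c|.
Qed.

Lemma Rintegral_le_cst (a b c : R) (f : R -> R) : a <= b -> continuous f ->
  (forall x, x \in `[a, b] -> `|f x| <= c) ->
  `|\int[mu]_(x in `[a, b]) f x| <= c * (b - a).
Proof.
move=> ab cf fc.
apply: le_trans (le_normr_Rintegral _ _) _ => //; first exact: continuous_integrable_itv.
rewrite (_ : c * (b - a) = \int[mu]_(x in `[a, b]) cst c x).
  apply: le_Rintegral => //.
    exact: integrable_norm (continuous_integrable_itv _ _ cf).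
  by apply: continuous_integrable_itv; exact: cst_continuous.
have <- : fine (mu `[a, b]%classic) = b - a.
  rewrite lebesgue_measure_itv/=.
  case: ifPn => //=; rewrite lte_fin -leNgt => ba.
  by have -> : a = b by [apply/eqP; rewrite eq_le ab]; rewrite subrr.
by rewrite Rintegral_cst.
Qed.

Variables (a b : R) (ab : a < b) (L : R -> R -> R -> R -> R) (sL : smooth L).

(** Uniform continuity of the partial derivatives along the curve makes the pointwise error of
    [mvt_estimate3] uniform in x, and it is then integrated. *)
Lemma frechet_variation (y u v : R -> R) (e : R) :
  continuous y -> continuous u -> continuous v -> 0 < e ->
  exists2 d : R, 0 < d & forall (h k m : R -> R) (r : R),
    continuous h -> continuous k -> continuous m -> r <= d ->
    (forall x, x \in `[a, b] -> [/\ `|h x| <= r, `|k x| <= r & `|m x| <= r]) ->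
    `|functional4 a b L (y \+ h) (u \+ k) (v \+ m) - functional4 a b L y u v -
      variation a b L y u v h k m| <= e * r.
Proof.
move=> cy cu cv e0.
have [[cL d2 d3 d4] [c2 c3 c4]] := sL.
(* The 3 stands for the three increments, b - a for the length of the interval of integration. *)
pose e' := e / (3 * (b - a)).
have e'0 : 0 < e' by rewrite divr_gt0 ?mulr_gt0 ?subr_gt0.
have [t2 t20 h2] := joint_uniform_continuous a b c2 cy cu cv e'0.
have [t3 t30 h3] := joint_uniform_continuous a b c3 cy cu cv e'0.
have [t4 t40 h4] := joint_uniform_continuous a b c4 cy cu cv e'0.
exists (Num.min t2 (Num.min t3 t4)); first by rewrite !lt_min t20 t30.
move=> h k m r ch ck cm; rewrite !le_min => /andP[r2 /andP[r3 r4]] hr.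
have cid : continuous (id : R -> R) by move=> x; exact: cvg_id.
have cD (f g : R -> R) : continuous f -> continuous g -> continuous (f \+ g).
  by move=> cf cg x; apply: cvgD; [exact: cf|exact: cg].
have cM (f g : R -> R) : continuous f -> continuous g -> continuous (fun x => f x * g x).
  by move=> cf cg x; apply: cvgM; [exact: cf|exact: cg].
have cA := continuous_joint_comp cL cid (cD _ _ cy ch) (cD _ _ cu ck) (cD _ _ cv cm).
have cB := continuous_joint_comp cL cid cy cu cv.
have cC : continuous (fun x => partial2 L x (y x) (u x) (v x) * h x +
    partial3 L x (y x) (u x) (v x) * k x + partial4 L x (y x) (u x) (v x) * m x).
  apply: (cD (fun x => _ + _) (fun x => _ * _)); last first.
    by apply: (cM (fun x => partial4 _ _ _ _ _)) => //; exact: continuous_joint_comp.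
  apply: (cD (fun x => _ * _) (fun x => _ * _)).
    by apply: (cM (fun x => partial2 _ _ _ _ _)) => //; exact: continuous_joint_comp.
  by apply: (cM (fun x => partial3 _ _ _ _ _)) => //; exact: continuous_joint_comp.
have cAB : continuous (fun x => L x (y x + h x) (u x + k x) (v x + m x) - L x (y x) (u x) (v x)).
  by move=> x; apply: cvgB; [exact: cA|exact: cB].
rewrite /functional4 /variation.
rewrite -RintegralB//; try exact: continuous_integrable_itv.
rewrite -RintegralB//; try exact: continuous_integrable_itv.
rewrite (_ : e * r = (e' * (r + r + r)) * (b - a)); last first.
  by rewrite /e'; field; rewrite subr_eq0 gt_eqF.
apply: Rintegral_le_cst; first exact: ltW.
  by move=> x; apply: cvgB; [exact: cAB|exact: cC].
move=> x xab; have [hx kx mx] := hr _ xab.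
apply: le_trans (mvt_estimate3 d2 d3 d4 (e := e') _) _.
  move=> h' k' m' hh kk mm; split.
  - by apply: h2 => //; [exact: le_trans hh (le_trans hx _)|
      exact: le_trans kk (le_trans kx _)|exact: le_trans mm (le_trans mx _)].
  - by apply: h3 => //; [exact: le_trans hh (le_trans hx _)|
      exact: le_trans kk (le_trans kx _)|exact: le_trans mm (le_trans mx _)].
  - by apply: h4 => //; [exact: le_trans hh (le_trans hx _)|
      exact: le_trans kk (le_trans kx _)|exact: le_trans mm (le_trans mx _)].
rewrite ler_wpM2l ?(ltW e'0)//.
by rewrite !lerD.
Qed.

End integral_functional.

(** This replaces the implicit function theorem: I is differentiable at the origin only, so the
    curve I = l need not be a graph there. The intermediate value theorem still finds a point on it
    with r negligible compared with s, and if B were nonzero, J would be below j at that point for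
    the right sign of s. *)
Lemma lagrange_condition (R : realType) (I J : R -> R -> R) (l j A B C : R) :
  0 < A -> (forall s, continuous (I s)) ->
  (forall e, 0 < e -> exists2 d, 0 < d & forall s r, `|s| <= d -> `|r| <= d ->
    `|I s r - l - A * r| <= e * (`|s| + `|r|)) ->
  (forall e, 0 < e -> exists2 d, 0 < d & forall s r, `|s| <= d -> `|r| <= d ->
    `|J s r - j - (B * s + C * r)| <= e * (`|s| + `|r|)) ->
  (exists2 d, 0 < d & forall s r, `|s| <= d -> `|r| <= d -> I s r = l -> j <= J s r) ->
  B = 0.
Proof.
move=> A0 cI dI dJ [d0 d00 Jmin].
have [//|B0] := eqVneq B 0; exfalso.
have nB : 0 < `|B| by rewrite normr_gt0.
have nC : 0 < `|C| + 1 by rewrite ltr_wpDl.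
(* The room left for r, namely |r| <= eta * |s|: it makes |C * r| at most a quarter of |B * s|. *)
pose eta := Num.min 1 (`|B| / (4 * (`|C| + 1))).
have eta0 : 0 < eta by rewrite lt_min ltr01 divr_gt0 ?mulr_gt0.
have eta1 : eta <= 1 by rewrite ge_min lexx.
have etaC : `|C| * eta <= `|B| / 4.
  apply: (@le_trans _ _ ((`|C| + 1) * (`|B| / (4 * (`|C| + 1))))).
    by apply: ler_pM => //; rewrite ?(ltW eta0) ?lerDl// ge_min lexx orbT.
  by rewrite le_eqVlt; apply/orP; left; apply/eqP; field; rewrite gt_eqF.
(* With this tolerance the error in I is at most half of the main term A * eta * t, so r = eta * t
   and r = - (eta * t) lie on opposite sides of the level l. *)
have e10 : 0 < eta * A / 4 by rewrite !mulr_gt0.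
have e20 : 0 < `|B| / 8 by rewrite mulr_gt0.
have [d1 d10 dI1] := dI _ e10.
have [d2 d20 dJ1] := dJ _ e20.
pose t := Num.min d0 (Num.min d1 d2).
have t0 : 0 < t by rewrite !lt_min d00 d10.
have [td0 td1 td2] : [/\ t <= d0, t <= d1 & t <= d2].
  by rewrite /t; split; rewrite !ge_min lexx ?orbT.
(* The sign is chosen so that the linear term B * s = - |B| * t lowers J. *)
pose s := - Num.sg B * t.
have ns : `|s| = t by rewrite /s normrM normrN normr_sg B0 mul1r gtr0_norm.
have Bs : B * s = - (`|B| * t) by rewrite /s normrEsg; ring.
have et : eta * t <= t by rewrite ger_pMl.
have et0 : 0 < eta * t by rewrite mulr_gt0.
have eAt : 0 < eta * A * t by rewrite !mulr_gt0.
have bd (r : R) : `|r| <= eta * t -> eta * A / 4 * (`|s| + `|r|) <= eta * A * t / 2.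
  move=> rt; apply: (@le_trans _ _ (eta * A / 4 * (t + t))).
    by rewrite ler_wpM2l ?(ltW e10)// ns lerD2l; lra.
  by lra.
have Ip : l <= I s (eta * t).
  have nr : `|eta * t| = eta * t by rewrite gtr0_norm.
  have := dI1 s (eta * t); rewrite ns nr => /(_ td1 (le_trans et td1)).
  have := bd (eta * t); rewrite nr ns lexx => /(_ isT) h1 /le_trans/(_ h1).
  by rewrite ler_norml => /andP[+ _]; lra.
have In : I s (- (eta * t)) <= l.
  have nr : `|- (eta * t)| = eta * t by rewrite normrN gtr0_norm.
  have := dI1 s (- (eta * t)); rewrite ns nr => /(_ td1 (le_trans et td1)).
  have := bd (- (eta * t)); rewrite nr ns lexx => /(_ isT) h1 /le_trans/(_ h1).
  by rewrite ler_norml => /andP[_ +]; lra.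
have [r rI Ir] : exists2 r, r \in `[- (eta * t), eta * t] & I s r = l.
  apply: IVT; first by lra.
    exact: continuous_subspaceT.
  by rewrite ge_min In/= le_max Ip orbT.
have nr : `|r| <= eta * t by rewrite ler_norml; rewrite in_itv/= in rI.
have nrt : `|r| <= t by lra.
have := Jmin s r; rewrite ns => /(_ td0 (le_trans nrt td0) Ir).
have := dJ1 s r; rewrite ns => /(_ td2 (le_trans nrt td2)).
rewrite ler_norml => /andP[_ +]; rewrite Bs.
(* Against the gain |B| * t stand this quarter and an expansion error of at most another quarter, so
   J s r < j. *)
have : C * r <= `|B| / 4 * t.
  apply: le_trans (ler_norm _) _; rewrite normrM.
  apply: (@le_trans _ _ (`|C| * (eta * t))); first by rewrite ler_wpM2l.
  by rewrite mulrA ler_wpM2r ?(ltW t0).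
have : `|B| / 8 * (t + `|r|) <= `|B| / 8 * (t + t) by rewrite ler_wpM2l ?(ltW e20)// lerD2l.
have : 0 < `|B| * t by rewrite mulr_gt0.
lra.
Qed.

(** * Caputo derivatives of perturbed functions *)

Section derivability_set.
Variable R : realType.
Notation mu := (@lebesgue_measure R).

Definition derivability_set (f : R -> R) : set R := fun t => derivable f t 1.

(* By Cauchy's criterion the set is a countable intersection of countable
   unions of closed sets. *)
Lemma measurable_derivable (F : R -> R) : continuous F ->
  measurable (derivability_set F).
Proof.
move=> cF.
pose q (t h : R) := h^-1 * (F (h + t) - F t).
pose C (n m : nat) := [set t | forall h h', h != 0 -> h' != 0 ->
  `|h| < m.+1%:R^-1 -> `|h'| < m.+1%:R^-1 -> `|q t h - q t h'| <= n.+1%:R^-1].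
have -> : derivability_set F = \bigcap_n \bigcup_m C n m.
  apply/seteqP; split => t /=.
  - move=> /cvg_ex[/= l ql] n _.
    have n0 : 0 < (n.+1%:R^-1 : R) / 2 by rewrite divr_gt0.
    have /cvgrPdist_lt/(_ _ n0) := ql.
    rewrite near_withinE => /nbhs_ballP[r /= r0 rq].
    have [m mr] : exists m, (m.+1%:R^-1 : R) < r.
      have /cvgrPdist_lt/(_ _ r0)[m _ /(_ m (leqnn m))] := @cvg_harmonic R.
      by rewrite /harmonic/= sub0r normrN ger0_norm// => ?; exists m.
    exists m => // h h' h0 h'0 hm h'm.
    have H k : k != 0 -> `|k| < m.+1%:R^-1 -> `|l - q t k| < n.+1%:R^-1 / 2.
      move=> k0 km; have := rq k; rewrite /ball/= sub0r normrN => /(_ (lt_trans km mr) k0).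
      by rewrite /q [k *: 1]mulr1.
    rewrite (_ : q t h - q t h' = (l - q t h') - (l - q t h)); last by ring.
    apply: ltW; apply: le_lt_trans (ler_normB _ _) _.
    by rewrite [ltRHS]splitr ltrD// H.
  - move=> tC; apply: cauchy_cvg; apply/cauchy_exP => e e0.
    have [n ne] : exists n, (n.+1%:R^-1 : R) < e.
      have /cvgrPdist_lt/(_ _ e0)[m _ /(_ m (leqnn m))] := @cvg_harmonic R.
      by rewrite /harmonic/= sub0r normrN ger0_norm// => ?; exists m.
    have [m _ Cm] := tC n I.
    have m0 : 0 < (m.+1%:R^-1 : R) by [].
    (* The quotient at one fixed admissible increment serves as the centre of the Cauchy ball. *)
    pose h0 : R := m.+1%:R^-1 / 2.
    have h00 : 0 < h0 by rewrite divr_gt0.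
    exists (q t h0); rewrite /= near_simpl near_withinE.
    apply/nbhs_ballP; exists (m.+1%:R^-1) => //= h; rewrite /ball/= sub0r normrN => hm hn0.
    apply: le_lt_trans ne; rewrite [h *: 1]mulr1; apply: Cm => //; first by rewrite gt_eqF.
    by rewrite gtr0_norm// /h0 ltr_pdivrMr// ltr_pMr// ltr1n.
apply: bigcapT_measurable => n; apply: bigcupT_measurable => m.
apply: closed_measurable.
have cq h : continuous (q ^~ h).
  move=> t; apply: cvgMr; apply: cvgB; last exact: cF.
  apply: (@continuous_comp _ _ _ (fun t => h + t) F); last exact: cF.
  by apply: cvgD; [exact: cvg_cst|exact: cvg_id].
have -> : C n m = \bigcap_(hh in [set hh : R * R | [/\ hh.1 != 0, hh.2 != 0,
    `|hh.1| < m.+1%:R^-1 & `|hh.2| < m.+1%:R^-1]])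
    ((fun t => `|q t hh.1 - q t hh.2|) @^-1` [set r | r <= n.+1%:R^-1]).
  apply/seteqP; split => [t Ct [h h'] [/= *]|t Ct h h' h0 h'0 hm h'm]; first exact: Ct.
  exact: (Ct (h, h')).
apply: closed_bigI => -[h h'] _; apply: preimage_closed; last exact: closed_le.
by move=> t _; apply: cvg_norm; apply: cvgB; exact: cq.
Qed.

(* Where f is not differentiable neither is f + p, and both values of [derive1]
   are the same junk value. *)
Lemma derive1D_indic (f p : R -> R) (t : R) : derivable p t 1 ->
  derive1 (f + p) t = derive1 f t + derive1 p t * \1_(derivability_set f) t.
Proof.
move=> dp; rewrite indicE; have [/set_mem df|/negP ndf] := boolP (t \in derivability_set f).
  by rewrite mulr1 !derive1E (deriveD df dp).
have {}ndf : ~ derivable f t 1 by move=> df; apply: ndf; exact: mem_set.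
have ndfp : ~ derivable (f + p) t 1.
  by move=> dfp; apply: ndf; have := derivableB dfp dp; rewrite addrK.
have E (g : R -> R) : ~ derivable g t 1 -> derive1 g t = point.
  by move=> ng; rewrite derive1E; apply: dvgP.
by rewrite (E _ ndfp) (E _ ndf) mulr0 addr0.
Qed.

End derivability_set.

Section absolutely_continuous.
Variable R : realType.
Notation mu := (@lebesgue_measure R).
Variables (a b : R) (ab : a < b).

Lemma absolutely_continuous_within (f : R -> R) :
  absolutely_continuous a b f -> {within `[a, b], continuous f}.
Proof.
move=> fac; apply/subspace_continuousP => x /=; rewrite in_itv/= => /andP[ax xb].
apply/cvgrPdist_lt => e e0; have [d d0 fd] := fac e e0.
have H u v : a <= u -> u <= v -> v <= b -> v - u < d -> `|f v - f u| < e.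
  move=> au uv vb uvd; have := fd 1%N (fun=> u) (fun=> v).
  rewrite !big_ord1; apply => //.
  by move=> i j _ _ _; rewrite !ord1.
rewrite near_withinE; apply/nbhs_ballP; exists d => //= y.
rewrite /ball/= in_itv/= => xy /andP[ay yb].
have [xley|ylex] := leP x y.
  rewrite distrC; apply: H => //; move: xy; rewrite distrC ger0_norm//; lra.
by apply: H => //; [exact: ltW|move: xy; rewrite gtr0_norm//; lra].
Qed.

(** Continuity of f is known only within [a, b], so measurability is first obtained for f composed
    with [clamp], which has the same derivability in the open interval. At a and b derivability of f
    depends on values outside [a, b], but these are single points. *)
Lemma measurable_derivable_itv (f : R -> R) : absolutely_continuous a b f ->
  measurable (derivability_set f `&` `[a, b]).
Proof.
move=> /absolutely_continuous_within cf.
have cF := continuous_clamp_comp (ltW ab) cf.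
have mD := measurable_derivable cF.
have sing (x : R) (A : set R) : measurable (A `&` [set x]).
  have [Ax|Ax] := pselect (A x).
    rewrite (_ : _ `&` _ = [set x]); first exact: measurable_set1.
    by apply/seteqP; split => [t []//|t /= ->].
  rewrite (_ : _ `&` _ = set0); first exact: measurable0.
  by apply/seteqP; split => [t [At tx]|//]; apply: Ax; rewrite -tx.
have -> : derivability_set f `&` `[a, b] =
  (derivability_set (f \o clamp a b) `&` `]a, b[) `|`
  ((derivability_set f `&` [set a]) `|` (derivability_set f `&` [set b])).
  have E t : t \in `]a, b[ -> \near t, f t = (f \o clamp a b) t.
    move=> tab; near=> s; rewrite /= clamp_id//.
    apply: subset_itv_oo_cc; near: s; exact: near_in_itvoo.
  apply/seteqP; split => [t [/= dt]|t].
    rewrite in_itv/= !le_eqVlt => /andP[/predU1P[ta|at_]]; first by move=> _; right; left.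
    move=> /predU1P[tb|tb]; first by right; right.
    have tab : t \in `]a, b[ by rewrite in_itv/= at_.
    left; split => //=; apply: near_eq_derivable dt => //; exact: E.
  move=> [[/= dt tab]|[[/= dt ta]|[/= dt tb]]]; last 2 first.
  - by split => //=; rewrite ta in_itv/= lexx ltW.
  - by split => //=; rewrite tb in_itv/= lexx ltW.
  split; last exact: subset_itv_oo_cc.
  rewrite /=; apply: near_eq_derivable dt => //.
  by near=> s; apply/esym; near: s; exact: E.
apply: measurableU; first by apply: measurableI => //; exact: measurable_itv.
by apply: measurableU; exact: sing.
Unshelve. all: by end_near. Qed.

Lemma lipschitz_absolutely_continuous (f : R -> R) (M : R) :
  (forall u v, a <= u -> u <= v -> v <= b -> `|f v - f u| <= M * (v - u)) ->
  absolutely_continuous a b f.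
Proof.
move=> fM e e0.
have M0 : 0 < `|M| + 1 by rewrite ltr_wpDl.
exists (e / (`|M| + 1)); first exact: divr_gt0.
move=> n u v uv _ S.
apply: (@le_lt_trans _ _ ((`|M| + 1) * \sum_(i < n) (v i - u i))).
  rewrite mulr_sumr; apply: ler_sum => i _.
  have [au [uvi vb]] := uv i.
  apply: le_trans (fM _ _ au uvi vb) _.
  by rewrite ler_wpM2r ?subr_ge0// (le_trans (ler_norm _))// lerDl.
by rewrite mulrC -ltr_pdivlMr.
Qed.

Lemma absolutely_continuousD (f g : R -> R) :
  absolutely_continuous a b f -> absolutely_continuous a b g ->
  absolutely_continuous a b (f + g).
Proof.
move=> fac gac e e0; have e20 : 0 < e / 2 by lra.
have [d d0 fd] := fac _ e20; have [d' d'0 gd] := gac _ e20.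
exists (Num.min d d'); first by rewrite lt_min d0.
move=> n u v uv tI; rewrite lt_min => /andP[S S'].
have := fd n u v uv tI S; have := gd n u v uv tI S'.
suff : \sum_(i < n) `|(f + g) (v i) - (f + g) (u i)| <=
   \sum_(i < n) `|f (v i) - f (u i)| + \sum_(i < n) `|g (v i) - g (u i)| by lra.
rewrite -big_split/=; apply: ler_sum => i _.
by rewrite opprD addrACA ler_normD.
Qed.

End absolutely_continuous.

Section primitive.
Variable R : realType.
Notation mu := (@lebesgue_measure R).

(* The base point a - 1 makes the primitive two-sidedly differentiable at a. *)
Definition prim (a : R) (f : R -> R) (x : R) : R :=
  \int[mu]_(t in `[a - 1, x]) f t - \int[mu]_(t in `[a - 1, a]) f t.

Lemma is_derive_prim (a : R) (f : R -> R) (x : R) : continuous f -> a <= x ->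
  is_derive x 1 (prim a f) (f x).
Proof.
move=> cf ax; have a1x : a - 1 < x by lra.
have xx1 : x < x + 1 by lra.
have [d dE] := continuous_FTC1_closed xx1 (continuous_integrable_itv (a - 1) (x + 1) cf) a1x (cf x).
have H : is_derive x 1 (fun x => \int[mu]_(t in `[a - 1, x]) f t) (f x).
  by rewrite -dE derive1E; exact/derivableP.
have := is_deriveB H (is_derive_cst (\int[mu]_(t in `[a - 1, a]) f t) x 1).
by rewrite subr0.
Qed.

Lemma derive1_prim (a : R) (f : R -> R) (x : R) : continuous f -> a <= x ->
  derive1 (prim a f) x = f x.
Proof. by move=> cf ax; have := is_derive_prim cf ax => h; rewrite derive1E derive_val. Qed.

Lemma primE (a : R) (f : R -> R) (x : R) : continuous f -> a <= x ->
  prim a f x = \int[mu]_(t in `[a, x]) f t.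
Proof.
move=> cf ax; rewrite /prim Rintegral_itvB//.
- rewrite Rintegral_itv_obnd_cbnd//.
  apply: integrableS (continuous_integrable_itv a x cf) => //.
  exact: subset_itv_oc_cc.
- exact: continuous_integrable_itv.
- by rewrite bnd_simp; lra.
Qed.

Lemma prim_lipschitz (a b M : R) (f : R -> R) : continuous f ->
  (forall t, t \in `[a, b] -> `|f t| <= M) ->
  forall u v, a <= u -> u <= v -> v <= b ->
    `|prim a f v - prim a f u| <= M * (v - u).
Proof.
move=> cf fM u v au uv vb.
have H t : t \in `[u, v] -> is_derive t 1 (prim a f) (f t).
  by rewrite in_itv/= => /andP[ut tv]; apply: is_derive_prim => //; exact: le_trans ut.
have [|t tuv ->] := MVT_segment uv (fun t h => H t (subset_itv_oo_cc h)).
  apply: continuous_in_subspaceT => t /[!inE] tuv.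
  by apply/differentiable_continuous/derivable1_diffP; have [] := H t tuv.
rewrite normrM (ger0_norm (_ : 0 <= v - u)) ?subr_ge0// ler_wpM2r ?subr_ge0//.
apply: fM; move: tuv; rewrite !in_itv/= => /andP[ut tv].
by rewrite (le_trans au ut) (le_trans tv).
Qed.

End primitive.

(** * Adding a primitive to a function of E *)

Section perturbation.
Variable R : realType.
Notation mu := (@lebesgue_measure R).
Variables (a b alp bet : R) (ab : a < b).
Hypotheses (halp : 0 < alp < 1) (hbet : 0 < bet < 1).
Variables (y f : R -> R).
Hypotheses (Ey : space_E a b alp bet y) (cf : continuous f).

(** By [derive1D_indic], passing from y to y + [prim a f] changes [derive1] by the function g below,
    which is f on D and 0 elsewhere. D fills [a, b] up to a null set, so g can be traded for f under
    an integral, and D is measurable, so g is a legitimate integrand. *)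
Let D := derivability_set y `&` `[a, b].
Let g t := f t * \1_D t.

Let mD : measurable D.
Proof. by apply: measurable_derivable_itv => //; have [[]] := Ey. Qed.

Let mf : measurable_fun setT f.
Proof. exact: continuous_measurable_fun. Qed.

Let mg : measurable_fun setT g.
Proof. by apply: measurable_funM => //; exact: measurable_indic. Qed.

Let derive1_perturbed t : t \in `[a, b] -> derive1 (y + prim a f) t = derive1 y t + g t.
Proof.
move=> tab; have at_ : a <= t by move: tab; rewrite in_itv/= => /andP[].
rewrite derive1D_indic ?derive1_prim//; last by have [] := is_derive_prim cf at_.
rewrite /g !indicE /D in_setI; congr (_ + _ * _%:R).
by rewrite [X in (_ && X)]mem_set// andbT.
Qed.

Let ae_gf (k : R -> R) (A : set R) : A `<=` `[a, b] ->
  {ae mu, forall t, A t -> (k t * g t)%:E = (k t * f t)%:E}.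
Proof.
move=> Aab; have [[_ dy] _ _ _ _] := Ey.
apply: (@filterS _ _ (ae_filter_ringOfSetsType mu) _ _ _ dy) => t dt /Aab tab; congr (_ * _)%:E.
rewrite /g indicE mem_set ?mulr1//; split => //=.
exact: dt.
Qed.

Let boundg (M : R) : (forall t, t \in `[a, b] -> `|f t| <= M) ->
  forall t, t \in `[a, b] -> `|g t| <= M.
Proof.
move=> fM t tab; apply: le_trans (fM _ tab).
rewrite normrM -[leRHS]mulr1 ler_wpM2l// indicE.
by case: (_ \in _); rewrite ?normr1 ?normr0.
Qed.

(** The decomposition with g holds at every point, which transfers integrability; only then is g
    replaced by f almost everywhere. The point a is left out as in [space_E]. *)
Lemma left_kernelD (x : R) : x \in `]a, b] ->
  mu.-integrable `[a, x] (EFin \o left_kernel alp (derive1 (y + prim a f)) x) /\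
  left_integral a alp (derive1 (y + prim a f)) x =
  left_integral a alp (derive1 y) x + left_integral a alp f x.
Proof.
have /andP[alp0 alp1] := halp.
move=> xab; move: (xab); rewrite in_itv/= => /andP[ax xb].
have [M fM] := continuous_bounded_itv a b cf.
have [_ /(_ x xab) iy _ _ _] := Ey.
have ig := integrable_left_kernel alp1 mg (boundg fM) xb.
have sub t : t \in `[a, x] -> t \in `[a, b].
  by rewrite !in_itv/= => /andP[-> tx]; exact: le_trans xb.
have E t : t \in `[a, x] -> left_kernel alp (derive1 (y + prim a f)) x t =
    left_kernel alp (derive1 y) x t + left_kernel alp g x t.
  by move=> tax; rewrite /left_kernel derive1_perturbed ?mulrDr// sub.
split.
  apply: eq_integrable (integrableD _ iy ig) => // t.
  by rewrite inE => /E /= ->.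
transitivity (\int[mu]_(t in `[a, x]) (left_kernel alp (derive1 y) x t + left_kernel alp g x t)).
  by apply: eq_Rintegral => t; rewrite inE => /E.
rewrite RintegralD//; congr (_ + _).
rewrite /left_integral /Rintegral; congr fine; apply: ae_eq_integral => //.
- by have /measurable_int := ig.
- by have /measurable_int := integrable_left_kernel alp1 mf fM xb.
- by apply: ae_gf => t; exact: sub.
Qed.

Lemma right_kernelD (x : R) : x \in `[a, b[ ->
  mu.-integrable `[x, b] (EFin \o right_kernel bet (derive1 (y + prim a f)) x) /\
  right_integral b bet (derive1 (y + prim a f)) x =
  right_integral b bet (derive1 y) x + right_integral b bet f x.
Proof.
have /andP[bet0 bet1] := hbet.
move=> xab; move: (xab); rewrite in_itv/= => /andP[ax xb].
have [M fM] := continuous_bounded_itv a b cf.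
have [_ _ _ /(_ x xab) iy _] := Ey.
have ig := integrable_right_kernel bet1 mg (boundg fM) ax.
have sub t : t \in `[x, b] -> t \in `[a, b].
  by rewrite !in_itv/= => /andP[xt ->]; rewrite (le_trans ax).
have E t : t \in `[x, b] -> right_kernel bet (derive1 (y + prim a f)) x t =
    right_kernel bet (derive1 y) x t + right_kernel bet g x t.
  by move=> tax; rewrite /right_kernel derive1_perturbed ?mulrDr// sub.
split.
  apply: eq_integrable (integrableD _ iy ig) => // t.
  by rewrite inE => /E /= ->.
transitivity (\int[mu]_(t in `[x, b]) (right_kernel bet (derive1 y) x t + right_kernel bet g x t)).
  by apply: eq_Rintegral => t; rewrite inE => /E.
rewrite RintegralD//; congr (_ + _).
rewrite /right_integral /Rintegral; congr fine; apply: ae_eq_integral => //.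
- by have /measurable_int := ig.
- by have /measurable_int := integrable_right_kernel bet1 mf fM ax.
- by apply: ae_gf => t; exact: sub.
Qed.

Let left_cont : {within `[a, b], continuous (left_integral a alp f)}.
Proof.
have /andP[alp0 alp1] := halp; have [M fM] := continuous_bounded_itv a b cf.
exact: (left_integral_continuous (ltW alp0) alp1 mf fM).
Qed.

Let right_cont : {within `[a, b], continuous (right_integral b bet f)}.
Proof.
have /andP[bet0 bet1] := hbet; have [M fM] := continuous_bounded_itv a b cf.
exact: (right_integral_continuous (ltW bet0) bet1 mf fM).
Qed.

(** Away from a this is [left_kernelD]. At a the Caputo derivative is a limit by definition, and the
    identity on ]a, b] passes to it because both terms on the right are continuous on [a, b]. *)
Lemma caputo_leftD (x : R) : x \in `[a, b] ->
  caputo_left a alp (y + prim a f) x =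
  caputo_left a alp y x + 1 / Gamma (1 - alp) * left_integral a alp f x.
Proof.
have oc t : a < t -> t <= b -> caputo_left_integral a alp (y + prim a f) t =
    caputo_left a alp y t + 1 / Gamma (1 - alp) * left_integral a alp f t.
  move=> at_ tb; rewrite {1}/caputo_left_integral; have [|_ ->] := @left_kernelD t; first by rewrite in_itv/= at_.
  by rewrite /caputo_left gt_eqF// mulrDr.
rewrite in_itv/= => /andP[ax xb]; rewrite {1}/caputo_left; case: eqP => [->|/eqP xa]; last first.
  by apply: oc => //; rewrite lt_neqAle eq_sym xa.
apply/cvg_lim => //.
have [_ _ cy _ _] := Ey.
have [_ cya _] := (continuous_within_itvP _ ab).1 cy.
have [_ cfa _] := (continuous_within_itvP _ ab).1 left_cont.
have H : (fun t => caputo_left a alp y t + 1 / Gamma (1 - alp) * left_integral a alp f t) @ a^'+ -->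
    caputo_left a alp y a + 1 / Gamma (1 - alp) * left_integral a alp f a.
  by apply: cvgD cya _; apply: cvgM cfa; exact: cvg_cst.
apply: cvg_trans H; apply: near_eq_cvg; near=> t.
have at_ : a < t by [].
have tb : t <= b by near: t; exact: nbhs_right_le.
by rewrite oc.
Unshelve. all: by end_near. Qed.

Lemma caputo_rightD (x : R) : x \in `[a, b] ->
  caputo_right b bet (y + prim a f) x =
  caputo_right b bet y x + -1 / Gamma (1 - bet) * right_integral b bet f x.
Proof.
have oc t : a <= t -> t < b -> caputo_right_integral b bet (y + prim a f) t =
    caputo_right b bet y t + -1 / Gamma (1 - bet) * right_integral b bet f t.
  move=> at_ tb; rewrite {1}/caputo_right_integral; have [|_ ->] := @right_kernelD t; first by rewrite in_itv/= at_.
  by rewrite /caputo_right lt_eqF// mulrDr.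
rewrite in_itv/= => /andP[ax xb]; rewrite {1}/caputo_right; case: eqP => [->|/eqP xa]; last first.
  by apply: oc => //; rewrite lt_neqAle xa.
apply/cvg_lim => //.
have [_ _ _ _ cy] := Ey.
have [_ _ cya] := (continuous_within_itvP _ ab).1 cy.
have [_ _ cfa] := (continuous_within_itvP _ ab).1 right_cont.
have H : (fun t => caputo_right b bet y t + -1 / Gamma (1 - bet) * right_integral b bet f t) @ b^'- -->
    caputo_right b bet y b + -1 / Gamma (1 - bet) * right_integral b bet f b.
  by apply: cvgD cya _; apply: cvgM cfa; exact: cvg_cst.
apply: cvg_trans H; apply: near_eq_cvg; near=> t.
have tb : t < b by [].
have at_ : a <= t by near: t; exact: nbhs_left_ge.
by rewrite oc.
Unshelve. all: by end_near. Qed.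

Lemma space_ED_prim : space_E a b alp bet (y + prim a f).
Proof.
have [[acy dy] _ cl _ cr] := Ey.
have [M fM] := continuous_bounded_itv a b cf.
split.
- split.
    apply: absolutely_continuousD => //.
    exact: lipschitz_absolutely_continuous (prim_lipschitz cf fM).
  apply: (@filterS _ _ (ae_filter_ringOfSetsType mu) _ _ _ dy) => t dt tab; have at_ : a <= t by move: tab; rewrite in_itv/= => /andP[].
  by apply: derivableD; [exact: dt|have [] := is_derive_prim cf at_].
- by move=> x xab; have [] := left_kernelD xab.
- have H : {within `[a, b], continuous (fun x => caputo_left a alp y x +
      1 / Gamma (1 - alp) * left_integral a alp f x)}.
    move=> x; apply: cvgD; first exact: cl.
    by apply: cvgMr; exact: left_cont.
  apply: subspace_eq_continuous H => x; rewrite inE => xab.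
  by rewrite /from_subspace caputo_leftD.
- by move=> x xab; have [] := right_kernelD xab.
- have H : {within `[a, b], continuous (fun x => caputo_right b bet y x +
      -1 / Gamma (1 - bet) * right_integral b bet f x)}.
    move=> x; apply: cvgD; first exact: cr.
    by apply: cvgMr; exact: right_cont.
  apply: subspace_eq_continuous H => x; rewrite inE => xab.
  by rewrite /from_subspace caputo_rightD.
Qed.

End perturbation.

Section primitives_in_E.
Variable R : realType.
Notation mu := (@lebesgue_measure R).
Variables (a b alp bet : R) (ab : a < b).
Hypotheses (halp : 0 < alp < 1) (hbet : 0 < bet < 1).

(** Perturbing the zero function puts [prim a f] itself in E, which the norm axioms demand of the
    variations. *)
Lemma space_E0 : space_E a b alp bet (cst 0).
Proof.
have d0 : derive1 (cst 0 : R -> R) = cst 0.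
  by apply/funext => t; rewrite derive1E derive_cst.
have lk0 gam x : left_kernel gam (cst 0) x = cst (0 : R).
  by apply/funext => t; rewrite /left_kernel mulr0.
have rk0 gam x : right_kernel gam (cst 0) x = cst (0 : R).
  by apply/funext => t; rewrite /right_kernel mulr0.
have li0 gam : caputo_left_integral a gam (cst (0 : R)) = cst 0.
  apply/funext => x; rewrite /caputo_left_integral /left_integral d0 lk0.
  by rewrite Rintegral_cst// mul0r mulr0.
have ri0 gam : caputo_right_integral b gam (cst (0 : R)) = cst 0.
  apply/funext => x; rewrite /caputo_right_integral /right_integral d0 rk0.
  by rewrite Rintegral_cst// mul0r mulr0.
split.
- split; last by apply: aeW => t _; exact: derivable_cst.
  apply: (@lipschitz_absolutely_continuous _ _ _ _ 0) => u v _ _ _.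
  by rewrite subrr normr0 mul0r.
- move=> x _; rewrite d0 lk0; exact: integrable0.
- suff -> : caputo_left a alp (cst 0) = cst 0.
    by apply: continuous_subspaceT; exact: cst_continuous.
  apply/funext => x; rewrite /caputo_left li0; case: eqP => // _.
  by apply: lim_cst.
- move=> x _; rewrite d0 rk0; exact: integrable0.
- suff -> : caputo_right b bet (cst 0) = cst 0.
    by apply: continuous_subspaceT; exact: cst_continuous.
  apply/funext => x; rewrite /caputo_right ri0; case: eqP => // _.
  by apply: lim_cst.
Qed.

Lemma space_E_prim (f : R -> R) : continuous f -> space_E a b alp bet (prim a f).
Proof.
by move=> cf; rewrite -[prim a f]add0r; exact: (space_ED_prim ab halp hbet space_E0 cf).
Qed.

End primitives_in_E.

(** * Expansion along a plane of variations *)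

Section two_parameter_family.
Variable R : realType.
Notation mu := (@lebesgue_measure R).
Variables (a b : R) (ab : a < b) (L : R -> R -> R -> R -> R) (sL : smooth L).

Lemma continuous_comb (f g : R -> R) (s r : R) : continuous f -> continuous g ->
  continuous (fun x => s * f x + r * g x).
Proof.
move=> cf cg x.
by apply: cvgD; apply: cvgMr; [exact: cf|exact: cg].
Qed.

Lemma variation_comb (y u v h1 k1 m1 h2 k2 m2 : R -> R) (s r : R) :
  continuous y -> continuous u -> continuous v ->
  continuous h1 -> continuous k1 -> continuous m1 ->
  continuous h2 -> continuous k2 -> continuous m2 ->
  variation a b L y u v (fun x => s * h1 x + r * h2 x)
    (fun x => s * k1 x + r * k2 x) (fun x => s * m1 x + r * m2 x) =
  s * variation a b L y u v h1 k1 m1 + r * variation a b L y u v h2 k2 m2.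
Proof.
move=> cy cu cv ch1 ck1 cm1 ch2 ck2 cm2.
have [_ [c2 c3 c4]] := sL.
have cid : continuous (id : R -> R) by move=> x; exact: cvg_id.
have cV h k m : continuous h -> continuous k -> continuous m ->
  continuous (fun x => partial2 L x (y x) (u x) (v x) * h x +
    partial3 L x (y x) (u x) (v x) * k x + partial4 L x (y x) (u x) (v x) * m x).
  move=> ch ck cm x; apply: cvgD; [apply: cvgD|].
  - by apply: cvgM; [exact: (continuous_joint_comp c2)|exact: ch].
  - by apply: cvgM; [exact: (continuous_joint_comp c3)|exact: ck].
  - by apply: cvgM; [exact: (continuous_joint_comp c4)|exact: cm].
rewrite /variation -!RintegralZl//; try by apply: continuous_integrable_itv; exact: cV.
rewrite -RintegralD//; last 2 first.
- apply: continuous_integrable_itv => x; apply: cvgMr; exact: cV.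
- apply: continuous_integrable_itv => x; apply: cvgMr; exact: cV.
by apply: eq_Rintegral => x _ /=; ring.
Qed.

Lemma functional4_expansion (y u v h1 k1 m1 h2 k2 m2 : R -> R) (e : R) :
  continuous y -> continuous u -> continuous v ->
  continuous h1 -> continuous k1 -> continuous m1 ->
  continuous h2 -> continuous k2 -> continuous m2 -> 0 < e ->
  exists2 d : R, 0 < d & forall s r, `|s| <= d -> `|r| <= d ->
    `|functional4 a b L (fun x => y x + (s * h1 x + r * h2 x))
        (fun x => u x + (s * k1 x + r * k2 x)) (fun x => v x + (s * m1 x + r * m2 x)) -
      functional4 a b L y u v -
      (s * variation a b L y u v h1 k1 m1 + r * variation a b L y u v h2 k2 m2)|
    <= e * (`|s| + `|r|).
Proof.
move=> cy cu cv ch1 ck1 cm1 ch2 ck2 cm2 e0.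
have [M1 hM1] := continuous_bounded_itv a b ch1; have [M2 hM2] := continuous_bounded_itv a b ck1; have [M3 hM3] := continuous_bounded_itv a b cm1.
have [M4 hM4] := continuous_bounded_itv a b ch2; have [M5 hM5] := continuous_bounded_itv a b ck2; have [M6 hM6] := continuous_bounded_itv a b cm2.
(* One positive bound for all six directions, so that M * (|s| + |r|) bounds every increment. The
   tolerance e / M cancels this M, and the radius d / (2 * M) keeps the bound below d. *)
pose M := 1 + `|M1| + `|M2| + `|M3| + `|M4| + `|M5| + `|M6|.
have M0 : 0 < M by rewrite /M; do !rewrite ltr_pwDl ?addr_ge0 ?ltr01//.
have MM : [/\ M1 <= M, M2 <= M, M3 <= M & [/\ M4 <= M, M5 <= M & M6 <= M]].
  have := (ler_norm M1, ler_norm M2, ler_norm M3, ler_norm M4, ler_norm M5, ler_norm M6).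
  move=> [[[[[? ?] ?] ?] ?] ?].
  have := (normr_ge0 M1, normr_ge0 M2, normr_ge0 M3, normr_ge0 M4, normr_ge0 M5, normr_ge0 M6).
  move=> [[[[[? ?] ?] ?] ?] ?].
  by rewrite /M; split; last split; lra.
have {MM} [L1 L2 L3 [L4 L5 L6]] := MM.
have eM0 : 0 < e / M by rewrite divr_gt0.
have [d d0 H] := frechet_variation ab sL cy cu cv eM0.
exists (d / (2 * M)); first by rewrite divr_gt0 ?mulr_gt0.
move=> s r sd rd.
rewrite -variation_comb//.
have -> : e * (`|s| + `|r|) = e / M * (M * (`|s| + `|r|)) by field; rewrite gt_eqF.
have lin (p q N1 N2 : R) : `|p| <= N1 -> N1 <= M -> `|q| <= N2 -> N2 <= M ->
    `|s * p + r * q| <= M * (`|s| + `|r|).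
  move=> pN N1M qN N2M; apply: le_trans (ler_normD _ _) _.
  rewrite !normrM mulrDr; apply: lerD; rewrite mulrC ler_wpM2r//.
    exact: le_trans pN N1M.
  exact: le_trans qN N2M.
apply: H; try exact: continuous_comb.
- rewrite -ler_pdivlMl//; apply: (@le_trans _ _ (d / (2 * M) + d / (2 * M))).
    exact: lerD.
  by rewrite le_eqVlt; apply/orP; left; apply/eqP; field; rewrite gt_eqF.
- move=> x xab; split.
  + exact: lin (hM1 _ xab) L1 (hM4 _ xab) L4.
  + exact: lin (hM2 _ xab) L2 (hM5 _ xab) L5.
  + exact: lin (hM3 _ xab) L3 (hM6 _ xab) L6.
Qed.

(** Differentiability implies continuity: the expansion is applied at the parameters (s, r0) with
    the second direction in both slots, the first coefficient being 0. Near r0 the functional then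
    varies by at most (1 + |V|) * |r - r0|. *)
Lemma functional4_continuous (y u v h1 k1 m1 h2 k2 m2 : R -> R) (s : R) :
  continuous y -> continuous u -> continuous v ->
  continuous h1 -> continuous k1 -> continuous m1 ->
  continuous h2 -> continuous k2 -> continuous m2 ->
  continuous (fun r : R => functional4 a b L (fun x => y x + (s * h1 x + r * h2 x))
        (fun x => u x + (s * k1 x + r * k2 x)) (fun x => v x + (s * m1 x + r * m2 x))).
Proof.
move=> cy cu cv ch1 ck1 cm1 ch2 ck2 cm2 r0.
have cD (f g h : R -> R) : continuous f -> continuous g -> continuous h ->
    continuous (fun x => f x + (s * g x + r0 * h x)).
  by move=> cf cg ch x; apply: cvgD; [exact: cf|exact: continuous_comb].
set V := variation a b L (fun x => y x + (s * h1 x + r0 * h2 x))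
   (fun x => u x + (s * k1 x + r0 * k2 x)) (fun x => v x + (s * m1 x + r0 * m2 x)) h2 k2 m2.
have [d d0 H] := functional4_expansion (cD _ _ _ cy ch1 ch2) (cD _ _ _ cu ck1 ck2)
  (cD _ _ _ cv cm1 cm2) ch2 ck2 cm2 ch2 ck2 cm2 (ltr01 : (0 : R) < 1).
apply/cvgrPdist_le => e e0.
have V0 : 0 < 1 + `|V| by rewrite ltr_pwDl.
apply/nbhs_ballP; exists (Num.min d (e / (1 + `|V|))).
  by rewrite /= lt_min d0 divr_gt0.
move=> r; rewrite /ball/= lt_min => /andP[rd re].
have {}H := H 0 (r - r0).
rewrite normr0 add0r mul0r add0r distrC mul1r in H.
have {H} := H (ltW d0) (ltW rd).
have E (f g h : R -> R) : (fun x => f x + (s * g x + r0 * h x) + (0 * h x + (r - r0) * h x)) =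
  (fun x => f x + (s * g x + r * h x)) by apply/funext => x; ring.
rewrite !E -/V => H; rewrite distrC.
set X := functional4 _ _ _ _ _ _ in H *; set Y := functional4 _ _ _ _ _ _ in H *.
have : `|(r - r0) * V| <= `|r0 - r| * `|V| by rewrite normrM distrC.
have : `|r0 - r| * (1 + `|V|) <= e by rewrite -ler_pdivlMr// ltW.
have -> : X - Y = (X - Y - (r - r0) * V) + (r - r0) * V by ring.
move: H => H H1 H2; apply: le_trans (ler_normD _ _) _.
lra.
Qed.

End two_parameter_family.

(** * Derivatives relative to an interval *)

Section relative_derivative.
Variable R : realType.
Notation mu := (@lebesgue_measure R).
Variables (a b : R) (ab : a < b).

Definition quotient (F : R -> R) (x t : R) : R := (F t - F x) / (t - x).

(** Uniqueness of limits needs each x, the endpoints included, to be a limit point of [a, b]; the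
    witness t lies to the right of x if x < b and to the left otherwise. *)
Lemma within_itv_proper (x : R) : x \in `[a, b] ->
  ProperFilter (within `[a, b] x^').
Proof.
rewrite in_itv/= => /andP[ax xb]; split; last exact: within_filter.
move=> H0; have : \forall t \near x, t != x -> `[a, b]%classic t -> False by exact: H0.
move=> /nbhs_ballP[e /= e0 /=] H {H0}.
have [xb'|bx] := ltP x b.
  pose t := Num.min (x + e / 2) b.
  have xt : x < t by rewrite lt_min xb' andbT; lra.
  have te : t <= x + e / 2 by rewrite ge_min lexx.
  apply: (H t); rewrite /ball/= ?gt_eqF//.
    by rewrite distrC gtr0_norm; lra.
  by rewrite in_itv/= ge_min lexx orbT andbT; lra.
pose t := Num.max (x - e / 2) a.
have tx : t < x by rewrite gt_max (lt_le_trans ab bx) andbT; lra.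
have te : x - e / 2 <= t by rewrite le_max lexx.
apply: (H t); rewrite /ball/= ?lt_eqF//.
  by rewrite gtr0_norm; lra.
by rewrite in_itv/= le_max lexx orbT/=; lra.
Qed.

Lemma quotient_unique (F : R -> R) (x l1 l2 : R) : x \in `[a, b] ->
  quotient F x @ within `[a, b] x^' --> l1 ->
  quotient F x @ within `[a, b] x^' --> l2 -> l1 = l2.
Proof.
move=> xab; have PF := within_itv_proper xab.
exact: cvg_unique.
Qed.

Lemma quotient_eq (F G : R -> R) (x l : R) : x \in `[a, b] ->
  (forall t, t \in `[a, b] -> F t = G t) ->
  quotient F x @ within `[a, b] x^' --> l ->
  quotient G x @ within `[a, b] x^' --> l.
Proof.
move=> xab FG; apply: cvg_trans; apply: near_eq_cvg.
by rewrite near_withinE; near=> t => tab; rewrite /quotient !FG.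
Unshelve. all: by end_near. Qed.

Lemma quotient_constant (F : R -> R) (x c l : R) : x \in `[a, b] ->
  (forall t, t \in `[a, b] -> F t = c) ->
  quotient F x @ within `[a, b] x^' --> l -> l = 0.
Proof.
move=> xab Fc /(quotient_eq (G := cst c) xab Fc) H.
apply: (quotient_unique xab H).
have -> : quotient (cst c) x = cst 0.
  by apply/funext => t; rewrite /quotient subrr mul0r.
exact: cvg_cst.
Qed.

Lemma quotientD (F G : R -> R) (x l1 l2 c : R) :
  quotient F x @ within `[a, b] x^' --> l1 ->
  quotient G x @ within `[a, b] x^' --> l2 ->
  quotient (fun t => F t + c * G t) x @ within `[a, b] x^' --> l1 + c * l2.
Proof.
move=> F1 G2.
have -> : quotient (fun t => F t + c * G t) x = fun t => quotient F x t + c * quotient G x t.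
  by apply/funext => t; rewrite /quotient; ring.
by apply: cvgD F1 _; apply: cvgMr.
Qed.

Lemma is_derive_quotient (F : R -> R) (x l : R) : is_derive x 1 F l ->
  quotient F x @ within `[a, b] x^' --> l.
Proof.
move=> [dF <-].
have H : quotient F x @ x^' --> 'D_1 F x.
  apply/cvgrPdist_lt => e e0.
  have /cvgrPdist_lt/(_ _ e0) : (fun h => h^-1 *: ((F \o shift x) (h *: 1) - F x)) @ 0^' --> 'D_1 F x by [].
  rewrite !near_withinE => /nbhs_ballP[d /= d0 H]; apply/nbhs_ballP; exists d => //= t xt tx.
  have := H (t - x); rewrite /ball/= sub0r normrN distrC => /(_ xt).
  by rewrite subr_eq0 => /(_ tx); rewrite [_ *: 1]mulr1 subrK /quotient mulrC.
by apply: cvg_trans H; apply: cvg_app; exact: cvg_within.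
Qed.

Lemma derivable_on_quotient (F : R -> R) (x : R) :
  derivable_on_itv a b F x ->
  quotient F x @ within `[a, b] x^' --> derive_on_itv a b F x.
Proof. by []. Qed.

Lemma derive_on_quotient (F : R -> R) (x l : R) : x \in `[a, b] ->
  quotient F x @ within `[a, b] x^' --> l -> derive_on_itv a b F x = l.
Proof.
by move=> xab; have PF := within_itv_proper xab; move/cvg_lim; apply.
Qed.

(** The primitive of f^2 is nonnegative and nondecreasing and vanishes at b, hence is 0 on [a, b];
    so is its derivative f^2. *)
Lemma Rintegral_sqr_eq0 (f : R -> R) : continuous f ->
  \int[mu]_(x in `[a, b]) (f x * f x) = 0 -> forall x, x \in `[a, b] -> f x = 0.
Proof.
move=> cf I0 x xab.
have cff : continuous (fun x => f x * f x) by move=> t; apply: cvgM; exact: cf.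
have ax : a <= x by move: xab; rewrite in_itv/= => /andP[].
suff : f x * f x = 0 by move/eqP; rewrite mulf_eq0 => /orP[]/eqP.
have := is_derive_quotient (is_derive_prim cff ax); apply: (quotient_constant (c := 0)) => // t.
rewrite in_itv/= => /andP[at_ tb]; rewrite primE//; apply/eqP; rewrite eq_le.
rewrite Rintegral_ge0 ?andbT; last by move=> s _; exact: sqr_ge0.
rewrite -I0 -subr_ge0 Rintegral_itvB//; [|exact: continuous_integrable_itv..].
by apply: Rintegral_ge0 => s _; exact: sqr_ge0.
Qed.

End relative_derivative.

(** * Test variations and the potential Q *)

Section test_functions.
Variable R : realType.
Notation mu := (@lebesgue_measure R).
Variables (a b alp bet : R) (ab : a < b).
Hypotheses (halp : 0 < alp < 1) (hbet : 0 < bet < 1).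

(* The variation [prim a f] and its two Caputo derivatives on [a, b], extended
   by constants. *)
Definition test_prim (f : R -> R) : R -> R := prim a f \o clamp a b.

Definition test_left (f : R -> R) : R -> R :=
  (fun x => 1 / Gamma (1 - alp) * left_integral a alp f x) \o clamp a b.

Definition test_right (f : R -> R) : R -> R :=
  (fun x => -1 / Gamma (1 - bet) * right_integral b bet f x) \o clamp a b.

(* The function Q: minus its derivative is A + RL_right phi + RL_left psi. *)
Definition potential (A phi psi : R -> R) (t : R) : R :=
  right_integral b 0 A t + 1 / Gamma (1 - alp) * right_integral b alp phi t
  + -1 / Gamma (1 - bet) * left_integral a bet psi t.

Lemma left_integral_within (gam : R) (f : R -> R) : 0 <= gam < 1 -> continuous f ->
  {within `[a, b], continuous (left_integral a gam f)}.
Proof.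
move=> /andP[g0 g1] cf; have [M fM] := continuous_bounded_itv a b cf.
exact: (left_integral_continuous g0 g1 (continuous_measurable_fun cf) fM).
Qed.

Lemma right_integral_within (gam : R) (f : R -> R) : 0 <= gam < 1 -> continuous f ->
  {within `[a, b], continuous (right_integral b gam f)}.
Proof.
move=> /andP[g0 g1] cf; have [M fM] := continuous_bounded_itv a b cf.
exact: (right_integral_continuous g0 g1 (continuous_measurable_fun cf) fM).
Qed.

Let halp' : 0 <= alp < 1.
Proof. by have /andP[/ltW -> ->] := halp. Qed.

Let hbet' : 0 <= bet < 1.
Proof. by have /andP[/ltW -> ->] := hbet. Qed.

Lemma continuous_test_prim (f : R -> R) : continuous f -> continuous (test_prim f).
Proof.
move=> cf; apply: continuous_clamp_comp; first exact: ltW.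
apply: continuous_in_subspaceT => t /[!inE]; rewrite /= in_itv/= => /andP[at_ _].
apply/differentiable_continuous/derivable1_diffP.
by have [] := is_derive_prim cf at_.
Qed.

Lemma continuous_test_left (f : R -> R) : continuous f -> continuous (test_left f).
Proof.
move=> cf; apply: continuous_clamp_comp; first exact: ltW.
by move=> x; apply: cvgMr; exact: left_integral_within.
Qed.

Lemma continuous_test_right (f : R -> R) : continuous f -> continuous (test_right f).
Proof.
move=> cf; apply: continuous_clamp_comp; first exact: ltW.
by move=> x; apply: cvgMr; exact: right_integral_within.
Qed.

Lemma potential_within (A phi psi : R -> R) :
  continuous A -> continuous phi -> continuous psi ->
  {within `[a, b], continuous (potential A phi psi)}.
Proof.
move=> cA cphi cpsi x; apply: cvgD; [apply: cvgD|].
- by apply: right_integral_within; rewrite ?lexx ?ltr01.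
- by apply: cvgMr; exact: right_integral_within.
- by apply: cvgMr; exact: left_integral_within.
Qed.

Lemma prim_comb (f g : R -> R) (s r : R) : continuous f -> continuous g ->
  prim a (fun x => s * f x + r * g x) = fun x => s * prim a f x + r * prim a g x.
Proof.
move=> cf cg; apply/funext => x; rewrite /prim.
have E c : \int[mu]_(t in `[a - 1, c]) (s * f t + r * g t) =
    s * \int[mu]_(t in `[a - 1, c]) f t + r * \int[mu]_(t in `[a - 1, c]) g t.
  have H (k : R) (h : R -> R) : continuous h -> mu.-integrable `[a - 1, c] (EFin \o (fun t => k * h t)).
    by move=> ch; apply: continuous_integrable_itv => t; apply: cvgMr; exact: ch.
  rewrite RintegralD//; [|exact: H..].
  by rewrite !RintegralZl//; exact: continuous_integrable_itv.
by rewrite !E; ring.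
Qed.

(** Integrability of the kernels is assumed rather than continuity of f and g because [RL_left_comb]
    knows its functions only through [has_continuous_RL_left]. *)
Lemma left_integral_comb (gam : R) (f g : R -> R) (s r x : R) :
  mu.-integrable `[a, x] (EFin \o left_kernel gam f x) ->
  mu.-integrable `[a, x] (EFin \o left_kernel gam g x) ->
  left_integral a gam (fun x => s * f x + r * g x) x =
  s * left_integral a gam f x + r * left_integral a gam g x.
Proof.
move=> fi gi; rewrite /left_integral -!RintegralZl// -RintegralD//.
- by apply: eq_Rintegral => t _; rewrite /left_kernel; ring.
- by apply: eq_integrable (integrableZl _ s fi).
- by apply: eq_integrable (integrableZl _ r gi).
Qed.

Lemma right_integral_comb (gam : R) (f g : R -> R) (s r x : R) :
  mu.-integrable `[x, b] (EFin \o right_kernel gam f x) ->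
  mu.-integrable `[x, b] (EFin \o right_kernel gam g x) ->
  right_integral b gam (fun x => s * f x + r * g x) x =
  s * right_integral b gam f x + r * right_integral b gam g x.
Proof.
move=> fi gi; rewrite /right_integral -!RintegralZl// -RintegralD//.
- by apply: eq_Rintegral => t _; rewrite /right_kernel; ring.
- by apply: eq_integrable (integrableZl _ s fi).
- by apply: eq_integrable (integrableZl _ r gi).
Qed.

Lemma test_prim_comb (f g : R -> R) (s r : R) : continuous f -> continuous g ->
  test_prim (fun x => s * f x + r * g x) = fun x => s * test_prim f x + r * test_prim g x.
Proof. by move=> cf cg; rewrite /test_prim prim_comb. Qed.

Lemma test_left_comb (f g : R -> R) (s r : R) : continuous f -> continuous g ->
  test_left (fun x => s * f x + r * g x) = fun x => s * test_left f x + r * test_left g x.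
Proof.
move=> cf cg; apply/funext => x; rewrite /test_left/=.
have [M fM] := continuous_bounded_itv a b cf; have [N gN] := continuous_bounded_itv a b cg.
have := clamp_in x (ltW ab); rewrite in_itv/= => /andP[_ xb].
have [/andP[_ alp1]] := halp; rewrite left_integral_comb; first by ring.
- exact: (integrable_left_kernel alp1 (continuous_measurable_fun cf) fM).
- exact: (integrable_left_kernel alp1 (continuous_measurable_fun cg) gN).
Qed.

Lemma test_right_comb (f g : R -> R) (s r : R) : continuous f -> continuous g ->
  test_right (fun x => s * f x + r * g x) = fun x => s * test_right f x + r * test_right g x.
Proof.
move=> cf cg; apply/funext => x; rewrite /test_right/=.
have [M fM] := continuous_bounded_itv a b cf; have [N gN] := continuous_bounded_itv a b cg.
have := clamp_in x (ltW ab); rewrite in_itv/= => /andP[ax _].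
have [/andP[_ bet1]] := hbet; rewrite right_integral_comb; first by ring.
- exact: (integrable_right_kernel bet1 (continuous_measurable_fun cf) fM).
- exact: (integrable_right_kernel bet1 (continuous_measurable_fun cg) gN).
Qed.

Lemma left_integral0E (f : R -> R) (x : R) :
  left_integral a 0 f x = \int[mu]_(t in `[a, x]) f t.
Proof.
by apply: eq_Rintegral => t _; rewrite /left_kernel oppr0 powRr0 mul1r.
Qed.

Lemma right_integral0E (f : R -> R) (x : R) :
  right_integral b 0 f x = \int[mu]_(t in `[x, b]) f t.
Proof.
by apply: eq_Rintegral => t _; rewrite /right_kernel oppr0 powRr0 mul1r.
Qed.

Lemma integral_by_fractional_parts (A phi psi f : R -> R) :
  continuous A -> continuous phi -> continuous psi -> continuous f ->
  \int[mu]_(x in `[a, b])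
    (A x * test_prim f x + phi x * test_left f x + psi x * test_right f x) =
  \int[mu]_(x in `[a, b]) (f x * potential A phi psi x).
Proof.
move=> cA cphi cpsi cf.
have [M1 hA] := continuous_bounded_itv a b cA.
have [M2 hphi] := continuous_bounded_itv a b cphi.
have [M3 hpsi] := continuous_bounded_itv a b cpsi.
have [M4 hf] := continuous_bounded_itv a b cf.
have mA := continuous_measurable_fun cA.
have mphi := continuous_measurable_fun cphi.
have mpsi := continuous_measurable_fun cpsi.
have mf := continuous_measurable_fun cf.
have [/andP[/ltW alp0 alp1] /andP[/ltW bet0 bet1]] := (halp, hbet).
have c01 := continuous_test_prim cf.
have c02 := continuous_test_left cf.
have c03 := continuous_test_right cf.
have cM (p q : R -> R) : continuous p -> continuous q -> continuous (fun x => p x * q x).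
  by move=> cp cq x; apply: cvgM; [exact: cp|exact: cq].
have iM (p q : R -> R) : continuous p -> {within `[a, b], continuous q} ->
    mu.-integrable `[a, b] (EFin \o (fun x => p x * q x)).
  move=> cp cq; apply: continuous_compact_integrable; first exact: segment_compact.
  by move=> x; apply: cvgM; [exact: (continuous_subspaceT cp)|exact: cq].
have iMc (c : R) (p q : R -> R) : continuous p -> {within `[a, b], continuous q} ->
    mu.-integrable `[a, b] (EFin \o (fun x => c * (p x * q x))).
  by move=> cp cq; apply: eq_integrable (integrableZl _ c (iM _ _ cp cq)).
have r0 := right_integral_within (gam := 0) (f := A).
have {}r0 := r0 (introT andP (conj (lexx 0) ltr01)) cA.
have r1 := right_integral_within halp' cphi.
have l1 := left_integral_within hbet' cpsi.
rewrite RintegralD//; last 2 first.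
- apply: continuous_integrable_itv => x; apply: cvgD; first exact: cM.
  exact: cM.
- by apply: continuous_integrable_itv; exact: cM.
rewrite RintegralD//; [|by apply: continuous_integrable_itv; exact: cM..].
have -> : \int[mu]_(x in `[a, b]) (f x * potential A phi psi x) =
  \int[mu]_(x in `[a, b]) (f x * right_integral b 0 A x) +
  1 / Gamma (1 - alp) * \int[mu]_(x in `[a, b]) (f x * right_integral b alp phi x) +
  -1 / Gamma (1 - bet) * \int[mu]_(x in `[a, b]) (f x * left_integral a bet psi x).
  rewrite -!RintegralZl; [|exact: measurable_itv|exact: iM|exact: measurable_itv|exact: iM].
  rewrite -RintegralD//; [|exact: iM|exact: iMc].
  rewrite -RintegralD//; last 2 first.
  - by apply: eq_integrable (integrableD _ (iM _ _ cf r0) (iMc (1 / Gamma (1 - alp)) _ _ cf r1)).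
  - exact: iMc.
  by apply: eq_Rintegral => x _; rewrite /potential; ring.
have inE' (p q : R -> R) : (forall x, x \in `[a, b] -> p x = q x) ->
    \int[mu]_(x in `[a, b]) p x = \int[mu]_(x in `[a, b]) q x.
  by move=> pq; apply: eq_Rintegral => x; rewrite inE => /pq.
(* One exchange of integrals per term: order 0 for the first, alp for the second, and bet for the
   third, where left and right trade places. *)
congr (_ + _ + _).
- rewrite -(Rintegral_left_right ltr01 mf mA hf hA).
  apply: inE' => x xab; rewrite /test_prim/= clamp_id// left_integral0E primE//.
  by move: xab; rewrite in_itv/= => /andP[].
- rewrite -(Rintegral_left_right alp1 mf mphi hf hphi) -RintegralZl; last 2 first.
  - exact: measurable_itv.
  - by apply: iM; [|exact: left_integral_within].
  by apply: inE' => x xab; rewrite /test_left/= clamp_id//; ring.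
- rewrite (Rintegral_left_right bet1 mpsi mf hpsi hf) -RintegralZl; last 2 first.
  - exact: measurable_itv.
  - by apply: iM; [|exact: right_integral_within].
  by apply: inE' => x xab; rewrite /test_right/= clamp_id//; ring.
Qed.

(** The hypotheses on Riemann-Liouville derivatives concern the functions along y, whereas Q is
    built from their clamped, continuous versions; this lets one pass between the two on [a, b]. *)
Lemma eq_potential (A phi psi phi' psi' : R -> R) (t : R) : t \in `[a, b] ->
  (forall x, x \in `[a, b] -> phi x = phi' x) ->
  (forall x, x \in `[a, b] -> psi x = psi' x) ->
  potential A phi psi t = potential A phi' psi' t.
Proof.
rewrite in_itv/= => /andP[at_ tb] ephi epsi.
have Ephi : right_integral b alp phi t = right_integral b alp phi' t.
  apply: eq_Rintegral => x; rewrite inE/= in_itv/= => /andP[tx xb].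
  by rewrite /right_kernel ephi// in_itv/= xb (le_trans at_).
have Epsi : left_integral a bet psi t = left_integral a bet psi' t.
  apply: eq_Rintegral => x; rewrite inE/= in_itv/= => /andP[ax xt].
  by rewrite /left_kernel epsi// in_itv/= ax (le_trans xt).
by rewrite /potential Ephi Epsi.
Qed.

Lemma potential_quotient (A phi psi : R -> R) (x : R) : x \in `[a, b] ->
  continuous A -> derivable_on_itv a b (right_integral b alp phi) x ->
  derivable_on_itv a b (left_integral a bet psi) x ->
  quotient (potential A phi psi) x @ within `[a, b] x^' -->
    - (A x + RL_right a b alp phi x + RL_left a b bet psi x).
Proof.
move=> xab cA /derivable_on_quotient dphi /derivable_on_quotient dpsi.
have ax : a <= x by move: xab; rewrite in_itv/= => /andP[].
have dA := is_derive_quotient a b (is_derive_prim cA ax).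
(* On [a, b] the order 0 right integral is the constant [prim a A b] minus [prim a A]. *)
have {}dA : quotient (right_integral b 0 A) x @ within `[a, b] x^' --> - A x.
  have H0 : quotient (cst (prim a A b)) x @ within `[a, b] x^' --> 0.
    have -> : quotient (cst (prim a A b)) x = cst 0.
      by apply/funext => t; rewrite /quotient subrr mul0r.
    exact: cvg_cst.
  have := quotientD (c := -1) H0 dA.
  rewrite add0r mulN1r; apply: quotient_eq => // t.
  rewrite in_itv/= => /andP[at_ tb].
  rewrite right_integral0E mulN1r !primE//; last exact: ltW.
  rewrite Rintegral_itvB//; last exact: continuous_integrable_itv.
  rewrite Rintegral_itv_obnd_cbnd//.
  apply: integrableS (continuous_integrable_itv t b cA) => //.
  exact: subset_itv_oc_cc.
have := quotientD (c := -1 / Gamma (1 - bet)) (quotientD (c := 1 / Gamma (1 - alp)) dA dphi) dpsi.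
suff -> : - (A x + RL_right a b alp phi x + RL_left a b bet psi x) =
  - A x + 1 / Gamma (1 - alp) * derive_on_itv a b (right_integral b alp phi) x +
  -1 / Gamma (1 - bet) * derive_on_itv a b (left_integral a bet psi) x by [].
rewrite /RL_right /RL_left.
have swap (p q r u v : R) : - (p + -1 / q * u + 1 / r * v) = - p + 1 / q * u + -1 / r * v by ring.
exact: swap.
Qed.

(** The relative derivative is a bare [lim], so linearity goes through convergence of the quotients
    and uniqueness of limits. F is prescribed on [a, b] only, since the partial derivatives of L +
    lam g split only there. *)
Lemma RL_right_comb (gam c : R) (F f g : R -> R) (x : R) : x \in `[a, b] ->
  has_continuous_RL_right a b gam f -> has_continuous_RL_right a b gam g ->
  (forall t, t \in `[a, b] -> F t = f t + c * g t) ->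
  RL_right a b gam F x = RL_right a b gam f x + c * RL_right a b gam g x.
Proof.
move=> xab [fi df _] [gi dg _] FE; rewrite /RL_right.
have := quotientD (c := c) (derivable_on_quotient (df x xab)) (derivable_on_quotient (dg x xab)).
move=> /(quotient_eq (G := right_integral b gam F) xab) H.
rewrite (derive_on_quotient ab xab (H _)); first by rewrite mulrDr mulrCA.
move=> t tab; rewrite -[X in X + _]mul1r -right_integral_comb; [|exact: fi|exact: gi].
apply: eq_Rintegral => z; rewrite inE/= in_itv/= => /andP[tz zb].
rewrite /right_kernel FE ?mul1r// in_itv/= zb andbT.
by move: tab; rewrite in_itv/= => /andP[at_ _]; exact: le_trans tz.
Qed.

Lemma RL_left_comb (gam c : R) (F f g : R -> R) (x : R) : x \in `[a, b] ->
  has_continuous_RL_left a b gam f -> has_continuous_RL_left a b gam g ->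
  (forall t, t \in `[a, b] -> F t = f t + c * g t) ->
  RL_left a b gam F x = RL_left a b gam f x + c * RL_left a b gam g x.
Proof.
move=> xab [fi df _] [gi dg _] FE; rewrite /RL_left.
have := quotientD (c := c) (derivable_on_quotient (df x xab)) (derivable_on_quotient (dg x xab)).
move=> /(quotient_eq (G := left_integral a gam F) xab) H.
rewrite (derive_on_quotient ab xab (H _)); first by rewrite mulrDr mulrCA.
move=> t tab; rewrite -[X in X + _]mul1r -left_integral_comb; [|exact: fi|exact: gi].
apply: eq_Rintegral => z; rewrite inE/= in_itv/= => /andP[az zt].
rewrite /left_kernel FE ?mul1r// in_itv/= az /=.
by move: tab; rewrite in_itv/= => /andP[_ tb]; exact: le_trans tb.
Qed.

End test_functions.

(** * The multiplier rule *)

Section lagrange_multiplier.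
Variable R : realType.
Notation mu := (@lebesgue_measure R).
Variables (a b alp bet : R) (ab : a < b).
Hypotheses (halp : 0 < alp < 1) (hbet : 0 < bet < 1).
Variable y : R -> R.
Hypothesis Ey : space_E a b alp bet y.

Definition y_clamped := y \o clamp a b.
Definition left_clamped := caputo_left a alp y \o clamp a b.
Definition right_clamped := caputo_right b bet y \o clamp a b.
Definition clamped (L : R -> R -> R -> R -> R) x := L (clamp a b x).

Lemma continuous_y_clamped : continuous y_clamped.
Proof.
apply: continuous_clamp_comp; first exact: ltW.
by apply: absolutely_continuous_within; have [[]] := Ey.
Qed.

Lemma continuous_left_clamped : continuous left_clamped.
Proof. have [_ _ cl _ _] := Ey; exact: continuous_clamp_comp (ltW ab) cl. Qed.

Lemma continuous_right_clamped : continuous right_clamped.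
Proof. have [_ _ _ _ cr] := Ey; exact: continuous_clamp_comp (ltW ab) cr. Qed.

Lemma continuous_idR : continuous (id : R -> R).
Proof. by move=> x; exact: cvg_id. Qed.

Definition along_clamped (L : R -> R -> R -> R -> R) (x : R) : R :=
  clamped L x (y_clamped x) (left_clamped x) (right_clamped x).

Lemma along_clampedE (L : R -> R -> R -> R -> R) (x : R) : x \in `[a, b] ->
  along_clamped L x = along a b alp bet L y x.
Proof. by move=> xab; rewrite /along_clamped /clamped /y_clamped /left_clamped /right_clamped/= !clamp_id. Qed.

Definition el_potential (L : R -> R -> R -> R -> R) : R -> R :=
  potential a b alp bet (along_clamped (partial2 L)) (along_clamped (partial3 L))
    (along_clamped (partial4 L)).

Definition el_expr (L : R -> R -> R -> R -> R) (x : R) : R :=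
  along a b alp bet (partial2 L) y x
  + RL_right a b alp (along a b alp bet (partial3 L) y) x
  + RL_left a b bet (along a b alp bet (partial4 L) y) x.

Definition family (L : R -> R -> R -> R -> R) (f1 f2 : R -> R) (s r : R) : R :=
  functional4 a b (clamped L)
    (fun x => y_clamped x + (s * test_prim a b f1 x + r * test_prim a b f2 x))
    (fun x => left_clamped x + (s * test_left a b alp f1 x + r * test_left a b alp f2 x))
    (fun x => right_clamped x + (s * test_right a b bet f1 x + r * test_right a b bet f2 x)).

Lemma functional_clampedE (L : R -> R -> R -> R -> R) :
  functional4 a b (clamped L) y_clamped left_clamped right_clamped = functional a b alp bet L y.
Proof.
by apply: eq_Rintegral => x; rewrite inE => xab; exact: along_clampedE.
Qed.

Lemma familyE (L : R -> R -> R -> R -> R) (f1 f2 : R -> R) (s r : R) :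
  continuous f1 -> continuous f2 ->
  family L f1 f2 s r =
  functional a b alp bet L (y + prim a (fun x => s * f1 x + r * f2 x)).
Proof.
move=> cf1 cf2; have c12 : continuous (fun x => s * f1 x + r * f2 x).
  exact: continuous_comb.
have E1 x := congr1 (@^~ x) (test_prim_comb a b s r cf1 cf2).
have E2 x := congr1 (@^~ x) (test_left_comb ab halp s r cf1 cf2).
have E3 x := congr1 (@^~ x) (test_right_comb ab hbet s r cf1 cf2).
apply: eq_Rintegral => x; rewrite inE => xab.
rewrite /along (caputo_leftD ab halp Ey c12 xab) (caputo_rightD ab hbet Ey c12 xab).
rewrite -E1 -E2 -E3.
by rewrite /clamped /y_clamped /left_clamped /right_clamped /test_prim /test_left /test_right/= !clamp_id.
Qed.

Section smooth_integrand.
Variable L : R -> R -> R -> R -> R.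
Hypothesis hL : C1_on_slab a b L.

Lemma smooth_clamped : smooth (clamped L).
Proof. exact: C1_smooth (ltW ab) hL. Qed.

Lemma continuous_along_partial2 : continuous (along_clamped (partial2 L)).
Proof. by have [_ [c _ _]] := smooth_clamped; exact: (continuous_joint_comp c (@continuous_idR) (@continuous_y_clamped) (@continuous_left_clamped) (@continuous_right_clamped)). Qed.

Lemma continuous_along_partial3 : continuous (along_clamped (partial3 L)).
Proof. by have [_ [_ c _]] := smooth_clamped; exact: (continuous_joint_comp c (@continuous_idR) (@continuous_y_clamped) (@continuous_left_clamped) (@continuous_right_clamped)). Qed.

Lemma continuous_along_partial4 : continuous (along_clamped (partial4 L)).
Proof. by have [_ [_ _ c]] := smooth_clamped; exact: (continuous_joint_comp c (@continuous_idR) (@continuous_y_clamped) (@continuous_left_clamped) (@continuous_right_clamped)). Qed.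

Lemma el_potential_within : {within `[a, b], continuous (el_potential L)}.
Proof. exact: (potential_within halp hbet (@continuous_along_partial2) (@continuous_along_partial3) (@continuous_along_partial4)). Qed.

Lemma family_expansion (f1 f2 : R -> R) (e : R) : continuous f1 -> continuous f2 ->
  0 < e -> exists2 d, 0 < d & forall s r, `|s| <= d -> `|r| <= d ->
  `|family L f1 f2 s r - functional a b alp bet L y -
    (\int[mu]_(x in `[a, b]) (f1 x * el_potential L x) * s +
     \int[mu]_(x in `[a, b]) (f2 x * el_potential L x) * r)| <= e * (`|s| + `|r|).
Proof.
move=> cf1 cf2 e0.
have [d d0 H] := functional4_expansion ab smooth_clamped (@continuous_y_clamped) (@continuous_left_clamped) (@continuous_right_clamped)
  (continuous_test_prim ab cf1) (continuous_test_left ab halp cf1)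
  (continuous_test_right ab hbet cf1) (continuous_test_prim ab cf2)
  (continuous_test_left ab halp cf2) (continuous_test_right ab hbet cf2) e0.
exists d => // s r sd rd; have := H s r sd rd.
rewrite functional_clampedE.
have E f : continuous f -> variation a b (clamped L) y_clamped left_clamped right_clamped (test_prim a b f)
    (test_left a b alp f) (test_right a b bet f) =
    \int[mu]_(x in `[a, b]) (f x * el_potential L x).
  by move=> cf; rewrite -(integral_by_fractional_parts ab halp hbet (@continuous_along_partial2) (@continuous_along_partial3) (@continuous_along_partial4) cf).
by rewrite !E// (mulrC s) (mulrC r).
Qed.

Lemma family_continuous (f1 f2 : R -> R) (s : R) : continuous f1 -> continuous f2 ->
  continuous (family L f1 f2 s).
Proof.
move=> cf1 cf2 r; have H := (functional4_continuous ab smooth_clamped (s := s) (@continuous_y_clamped) (@continuous_left_clamped) (@continuous_right_clamped)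
  (continuous_test_prim ab cf1) (continuous_test_left ab halp cf1)
  (continuous_test_right ab hbet cf1) (continuous_test_prim ab cf2)
  (continuous_test_left ab halp cf2) (continuous_test_right ab hbet cf2)).
exact: H.
Qed.

Lemma el_potential_quotient (x : R) : x \in `[a, b] ->
  has_continuous_RL_right a b alp (along a b alp bet (partial3 L) y) ->
  has_continuous_RL_left a b bet (along a b alp bet (partial4 L) y) ->
  quotient (el_potential L) x @ within `[a, b] x^' --> - el_expr L x.
Proof.
move=> xab [_ d3 _] [_ d4 _].
have H := potential_quotient ab xab (@continuous_along_partial2) (d3 x xab) (d4 x xab).
rewrite (along_clampedE (partial2 L) xab) in H.
refine (quotient_eq xab _ H) => t tab.
by rewrite /el_potential; apply: (eq_potential _ _ _ tab) => z zab; rewrite along_clampedE.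
Qed.

End smooth_integrand.

(* du Bois-Reymond: testing Q against itself minus its mean value. *)
Lemma centered_test (Q : R -> R) : {within `[a, b], continuous Q} ->
  exists f : R -> R, exists c : R,
  [/\ continuous f, \int[mu]_(x in `[a, b]) f x = 0,
      forall x, x \in `[a, b] -> Q x = f x + c &
      \int[mu]_(x in `[a, b]) (f x * Q x) = \int[mu]_(x in `[a, b]) (f x * f x)].
Proof.
move=> cQ; have cQ' := continuous_clamp_comp (ltW ab) cQ.
pose c := (\int[mu]_(x in `[a, b]) (Q \o clamp a b) x) / (b - a).
pose f x := (Q \o clamp a b) x - c.
have cf : continuous f by move=> x; apply: cvgB; [exact: cQ'|exact: cvg_cst].
have If : \int[mu]_(x in `[a, b]) f x = 0.
  rewrite RintegralB//; last 2 first.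
  - exact: continuous_integrable_itv.
  - by apply: continuous_integrable_itv; exact: cst_continuous.
  have Ic : \int[mu]_(x in `[a, b]) (cst c x) = c * (b - a).
    rewrite Rintegral_cst//; congr (_ * _).
    have : fine (mu `[a, b]%classic) = b - a by rewrite lebesgue_measure_itv/= lte_fin ab.
    by [].
  rewrite [X in _ - X]Ic /c mulfVK ?subrr// subr_eq0 gt_eqF//.
exists f, c; split => //.
  by move=> x xab; rewrite /f/= clamp_id// subrK.
(* The mean value c contributes c times the integral of f, which is 0. *)
have E x : x \in `[a, b] -> f x * Q x = f x * f x + c * f x.
  by move=> xab; rewrite /f/= clamp_id//; ring.
transitivity (\int[mu]_(x in `[a, b]) (f x * f x + c * f x)).
  by apply: eq_Rintegral => x; rewrite inE => /E.
rewrite RintegralD//; last 2 first.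
- by apply: continuous_integrable_itv => x; apply: cvgM; exact: cf.
- by apply: continuous_integrable_itv => x; apply: cvgMr; exact: cf.
rewrite RintegralZl//; last exact: continuous_integrable_itv.
by rewrite If mulr0 addr0.
Qed.

End lagrange_multiplier.

(** * Linearity of the Euler-Lagrange expression in the Lagrangian *)

Lemma derive1_comb (R : realType) (f g : R -> R) (c x : R) :
  derivable f x 1 -> derivable g x 1 ->
  derive1 (fun s => f s + c * g s) x = derive1 f x + c * derive1 g x.
Proof.
move=> df dg; have dcg := derivableZ (k := c) dg.
transitivity (derive1 (f + c \*: g) x); first by [].
by rewrite !derive1E (deriveD df dcg) (deriveZ c dg).
Qed.

Lemma partial_comb (R : realType) (a b : R) (L g : R -> R -> R -> R -> R)
    (c x y u v : R) : C1_on_slab a b L -> C1_on_slab a b g -> x \in `[a, b] ->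
  let F x y u v := L x y u v + c * g x y u v in
  [/\ partial2 F x y u v = partial2 L x y u v + c * partial2 g x y u v,
      partial3 F x y u v = partial3 L x y u v + c * partial3 g x y u v &
      partial4 F x y u v = partial4 L x y u v + c * partial4 g x y u v].
Proof.
move=> [dL _] [dg _] xab F.
have [_ L2 L3 L4] := dL x y u v xab; have [_ g2 g3 g4] := dg x y u v xab.
split.
- exact: (@derive1_comb _ (fun s => L x s u v) (fun s => g x s u v) c y L2 g2).
- exact: (@derive1_comb _ (fun s => L x y s v) (fun s => g x y s v) c u L3 g3).
- exact: (@derive1_comb _ (fun s => L x y u s) (fun s => g x y u s) c v L4 g4).
Qed.

Lemma el_expr_comb (R : realType) (a b alp bet : R) (L g : R -> R -> R -> R -> R)
    (y : R -> R) (lam x : R) : a < b ->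
  C1_on_slab a b L -> C1_on_slab a b g ->
  has_continuous_RL_right a b alp (along a b alp bet (partial3 L) y) ->
  has_continuous_RL_right a b alp (along a b alp bet (partial3 g) y) ->
  has_continuous_RL_left a b bet (along a b alp bet (partial4 L) y) ->
  has_continuous_RL_left a b bet (along a b alp bet (partial4 g) y) ->
  x \in `[a, b] ->
  el_expr a b alp bet y (fun x s u v => L x s u v + lam * g x s u v) x =
  el_expr a b alp bet y L x + lam * el_expr a b alp bet y g x.
Proof.
move=> ab hL hg hL3 hg3 hL4 hg4 xab; rewrite /el_expr.
have E t := @partial_comb _ _ _ _ _ lam t (y t) (caputo_left a alp y t) (caputo_right b bet y t) hL hg.
have E2 t : t \in `[a, b] ->
    along a b alp bet (partial2 (fun x s u v => L x s u v + lam * g x s u v)) y t =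
    along a b alp bet (partial2 L) y t + lam * along a b alp bet (partial2 g) y t.
  by move=> tab; have [E2 _ _] := E t tab; exact: E2.
have E3 t : t \in `[a, b] ->
    along a b alp bet (partial3 (fun x s u v => L x s u v + lam * g x s u v)) y t =
    along a b alp bet (partial3 L) y t + lam * along a b alp bet (partial3 g) y t.
  by move=> tab; have [_ E3 _] := E t tab; exact: E3.
have E4 t : t \in `[a, b] ->
    along a b alp bet (partial4 (fun x s u v => L x s u v + lam * g x s u v)) y t =
    along a b alp bet (partial4 L) y t + lam * along a b alp bet (partial4 g) y t.
  by move=> tab; have [_ _ E4] := E t tab; exact: E4.
rewrite (E2 x xab) (RL_right_comb ab xab hL3 hg3 E3) (RL_left_comb ab xab hL4 hg4 E4).
by rewrite [X in X + _]addrACA [LHS]addrACA -!mulrDr.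
Qed.

Lemma el_expr_eq0 (R : realType) (a b alp bet : R) (L : R -> R -> R -> R -> R)
    (y : R -> R) : (forall x, x \in `[a, b] -> el_expr a b alp bet y L x = 0) ->
  euler_lagrange a b alp bet L y.
Proof. by []. Qed.

(** With n1 and n2 the norms of two fixed variations, this keeps s w + r f2 inside the ball of
    minimality, whatever the norm is. The 1 added to n1 + n2 keeps the denominator positive if both
    vanish. *)
Lemma small_combination (R : realType) (n1 n2 d : R) :
  0 <= n1 -> 0 <= n2 -> 0 < d ->
  exists2 e : R, 0 < e & forall s r : R, `|s| <= e -> `|r| <= e -> `|s| * n1 + `|r| * n2 < d.
Proof.
move=> n10 n20 d0; have K0 : 0 < n1 + n2 + 1 by lra.
exists (d / (2 * (n1 + n2 + 1))); first by rewrite divr_gt0 ?mulr_gt0.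
set e := _ / _ => s r se re.
have e0 : 0 < e by rewrite divr_gt0 ?mulr_gt0.
have eK : e * (n1 + n2 + 1) = d / 2 by rewrite /e; field; rewrite gt_eqF.
apply: (@le_lt_trans _ _ (e * n1 + e * n2)); last by lra.
by apply: lerD; rewrite ler_wpM2r.
Qed.

Unset Implicit Arguments.

Theorem theorem3p3 (R : realType) (a b alp bet ya yb l : R)
    (L g : R -> R -> R -> R -> R) (N : (R -> R) -> R) (y : R -> R)
    (hab : a < b)
    (halp : 0 < alp < 1) (hbet : 0 < bet < 1)
    (hL : C1_on_slab a b L) (hg : C1_on_slab a b g)
    (hL3 : has_continuous_RL_right a b alp (along a b alp bet (partial3 L) y))
    (hg3 : has_continuous_RL_right a b alp (along a b alp bet (partial3 g) y))
    (hL4 : has_continuous_RL_left a b bet (along a b alp bet (partial4 L) y))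
    (hg4 : has_continuous_RL_left a b bet (along a b alp bet (partial4 g) y))
    (hN : is_norm_on_E a b alp bet N)
    (hmin : local_minimum a b alp bet ya yb l N L g y)
    (hext : ~ extremal a b alp bet ya yb l g y) :
  exists lam : R,
    euler_lagrange a b alp bet
      (fun x s u v => L x s u v + lam * g x s u v) y.
Proof.
have [Hadm [d d0 ymin]] := hmin.
have [Ey ya_ yb_ Iy] := Hadm.
have cQL := el_potential_within hab halp hbet Ey hL.
have cQg := el_potential_within hab halp hbet Ey hg.
have dQL x xab := el_potential_quotient hab Ey hL (x := x) xab hL3 hL4.
have dQg x xab := el_potential_quotient hab Ey hg (x := x) xab hg3 hg4.
have expL := family_expansion hab halp hbet Ey hL.
have expg := family_expansion hab halp hbet Ey hg.
have contg := family_continuous hab halp hbet Ey hg.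
have perL := familyE hab halp hbet Ey L.
have perg := familyE hab halp hbet Ey g.
move: cQL cQg dQL dQg expL expg.
move: (el_potential a b alp bet y L) (el_potential a b alp bet y g) => QL Qg.
move=> cQL cQg dQL dQg expL expg.
have [f2 [c2 [cf2 If2 Qg_f2 f2Q]]] := centered_test hab cQg.
pose Int (f q : R -> R) := \int[@lebesgue_measure R]_(x in `[a, b]) (f x * q x).
have sq_ge0 f : 0 <= Int f f by apply: Rintegral_ge0 => x _; exact: sqr_ge0.
pose A2 := Int f2 Qg.
have A20 : 0 < A2.
  (* If the square integral of f2 were 0, then Qg would be the constant c2, and its relative
     derivative, minus the Euler-Lagrange expression of g, would vanish. *)
  rewrite lt_neqAle /A2 /Int f2Q sq_ge0 andbT; apply/eqP => A0; apply: hext; split => //.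
  have f20 := Rintegral_sqr_eq0 hab cf2 (esym A0).
  apply: el_expr_eq0 => x xab; apply/eqP; rewrite -oppr_eq0; apply/eqP.
  apply: (quotient_constant hab xab (c := c2) _ (dQg x xab)) => t tab.
  by rewrite Qg_f2// f20// add0r.
(* This value makes f2 orthogonal to QL + lam * Qg, so correcting f1 by a multiple of f2 will not
   change its pairing with that function. *)
pose lam := - Int f2 QL / A2; exists lam.
have cQ : {within `[a, b], continuous (fun t => QL t + lam * Qg t)}.
  by move=> t; apply: cvgD; [exact: cQL|apply: cvgMr; exact: cQg].
have [f1 [c1 [cf1 If1 Q_f1 f1Q]]] := centered_test hab cQ.
have iM (f q : R -> R) : continuous f -> {within `[a, b], continuous q} ->
    (@lebesgue_measure R).-integrable `[a, b] (EFin \o (fun x => f x * q x)).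
  move=> cf cq; apply: continuous_compact_integrable; first exact: segment_compact.
  by move=> x; apply: cvgM; [exact: (continuous_subspaceT cf)|exact: cq].
have iMc (c : R) (f q : R -> R) : continuous f -> {within `[a, b], continuous q} ->
    (@lebesgue_measure R).-integrable `[a, b] (EFin \o (fun x => c * (f x * q x))).
  by move=> cf cq; apply: eq_integrable (integrableZl _ c (iM _ _ cf cq)).
pose A1 := Int f1 Qg.
(* The multiple of f2 that removes the first-order change of the constraint along w. *)
pose k := - (A1 / A2).
pose w x := 1 * f1 x + k * f2 x.
have cw : continuous w by exact: continuous_comb.
have Int_w (q : R -> R) : {within `[a, b], continuous q} -> Int w q = Int f1 q + k * Int f2 q.
  move=> cq; rewrite /Int -RintegralZl//; last exact: iM.
  rewrite -RintegralD//; [|exact: iM|exact: iMc].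
  by apply: eq_Rintegral => x _; rewrite /w; ring.
have wg : Int w Qg = 0.
  by rewrite Int_w// -/A1 -/A2 /k mulNr divfK ?subrr// gt_eqF.
have wL : Int w QL = Int f1 f1.
  rewrite Int_w// [RHS]/Int -f1Q.
  (* The choices of k and lam give k * Int f2 QL = lam * Int f1 Qg. *)
  transitivity (Int f1 QL + lam * Int f1 Qg).
    have swap (p q r : R) : - (p / q) * r = - r / q * p by ring.
    by rewrite -/A1 /k /lam swap.
  rewrite /Int -RintegralZl//; last exact: iM.
  rewrite -RintegralD//; [|exact: iM|exact: iMc].
  by apply: eq_Rintegral => x _; ring.
have Iw : \int[@lebesgue_measure R]_(x in `[a, b]) w x = 0.
  have i1 : (@lebesgue_measure R).-integrable `[a, b] (EFin \o f1) by exact: continuous_integrable_itv.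
  have i2 : (@lebesgue_measure R).-integrable `[a, b] (EFin \o f2) by exact: continuous_integrable_itv.
  rewrite RintegralD//; last 2 first.
  - by apply: continuous_integrable_itv => x; apply: cvgMr; exact: cf1.
  - by apply: continuous_integrable_itv => x; apply: cvgMr; exact: cf2.
  by rewrite !RintegralZl// If1 If2 !mulr0 addr0.
have [N0 N1 N2 N3] := hN.
have Ew : space_E a b alp bet (prim a w) by exact: space_E_prim.
have Ef2 : space_E a b alp bet (prim a f2) by exact: space_E_prim.
have B0 : Int w QL = 0.
  apply: (@lagrange_condition _ (family a b alp bet y g w f2)
    (family a b alp bet y L w f2) l (functional a b alp bet L y) A2 _ (Int f2 QL)) => //.
  - by move=> s; exact: contg.
  - move=> e e0; have [d' d'0 H] := expg w f2 e cw cf2 e0.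
    exists d' => // s r sd rd; have := H s r sd rd.
    by rewrite Iy -/(Int w Qg) wg mul0r add0r.
  - move=> e e0; exact: expL.
  - have [d' d'0 Nd] := small_combination (N0 _ Ew) (N0 _ Ef2) d0.
    exists d' => [//|s r sd rd].
    rewrite perg; [rewrite perL; [|exact: cw|exact: cf2]|exact: cw|exact: cf2].
    move=> Ig.
    have c12 : continuous (fun x => s * w x + r * f2 x) by exact: continuous_comb.
    apply: ymin.
      split; last exact: Ig.
      + exact: space_ED_prim.
      + by rewrite /GRing.add/= primE// set_itv1 Rintegral_set1 addr0.
      (* The variation vanishes at b because w and f2 both have mean value zero. *)
      + rewrite -[RHS]addr0 -yb_; congr (_ + _); rewrite primE ?(ltW hab)//.
        rewrite RintegralD//; last 2 first.
        * by apply: continuous_integrable_itv => x; apply: cvgMr; exact: cw.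
        * by apply: continuous_integrable_itv => x; apply: cvgMr; exact: cf2.
        by rewrite !RintegralZl ?Iw ?If2 ?mulr0 ?addr0//; exact: continuous_integrable_itv.
    have -> : y - (y + prim a (fun x => s * w x + r * f2 x)) =
        (- s) *: prim a w + (- r) *: prim a f2.
      rewrite prim_comb//; apply/funext => x.
      suff H (p u v : R) : p - (p + (s * u + r * v)) = - s * u + - r * v by exact: H.
      by ring.
    (* The triangle inequality requires each multiple to lie in E; it is written as the primitive of
       a combination with one zero coefficient. *)
    have Esw : space_E a b alp bet ((- s) *: prim a w).
      have -> : (- s) *: prim a w = prim a (fun x => (- s) * w x + 0 * f2 x).
        by rewrite (@prim_comb _ a w f2)//; apply/funext => x /=; rewrite mul0r addr0.
      by apply: space_E_prim => //; exact: continuous_comb.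
    have Erf : space_E a b alp bet ((- r) *: prim a f2).
      have -> : (- r) *: prim a f2 = prim a (fun x => 0 * w x + (- r) * f2 x).
        by rewrite (@prim_comb _ a w f2)//; apply/funext => x /=; rewrite mul0r add0r.
      by apply: space_E_prim => //; exact: continuous_comb.
    apply: le_lt_trans (N3 _ _ Esw Erf) _.
    rewrite !N2// !normrN.
    exact: Nd.
have f10 := Rintegral_sqr_eq0 hab cf1 (etrans (esym wL) B0).
apply: el_expr_eq0 => x xab.
rewrite el_expr_comb//; apply/eqP; rewrite -oppr_eq0 opprD -mulrN; apply/eqP.
(* Since f1 = 0, QL + lam * Qg is the constant c1, and its relative derivative is minus the
   Euler-Lagrange expression of L + lam g. *)
apply: (quotient_constant hab xab (c := c1) _ (quotientD (dQL x xab) (dQg x xab))) => t tab.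
by rewrite Q_f1// f10// add0r.
Qed.
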